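(* Let $n,m\in\mathbb N$ and let $\pi=\begin{bmatrix}\circ&\bullet\\ \bullet&\circ\end{bmatrix}$ be the only partition in $P_{even}(2,2)$ having crossings. Then $\bar\varphi_\pi(A)=2A^\delta-A^t$ for $A\in M_n(\mathbb C)$, and, with $W$ a complex Wishart matrix of parameters $(dn,dm)$, the $d\to\infty$ asymptotic distribution (in $*$-moments) of the block-modified Wishart matrix $(id\otimes\bar\varphi_\pi)W$ is the same as that of $(id\otimes\varphi_\pi)W$, where $\varphi_\pi(A)=A^t$.
   Context: $P_{even}(2,2)$ is the set of partitions of an upper row of 2 points and a lower row of 2 points with all blocks of even size; $\pi$ connects upper left with lower right and upper right with lower left. $A^\delta$ is the diagonal part of $A$ and $A^t$ its transpose. Untwisted and twisted maps $M_n(\mathbb C)\to M_n(\mathbb C)$: $$\varphi_\pi(e_{ac})=\sum_{bd}\delta_\pi\begin{pmatrix}a&c\\ b&d\end{pmatrix}e_{bd},\qquad \bar\varphi_\pi(e_{ac})=\sum_{\nu\leq\pi}\varepsilon(\nu)\sum_{b,d:\,\ker\binom{a\ c}{b\ d}=\nu}e_{bd},$$ where $\delta_\pi=1$ if each block of $\pi$ contains equal indices and $0$ otherwise, $\nu\leq\pi$ means that $\nu$ is obtained from $\pi$ by merging blocks, $\ker$ is the partition whose blocks collect the positions with equal indices, and $\varepsilon(\nu)=(-1)^k$, with $k$ the number of switches between neighboring legs (in the same row, belonging to different blocks) needed to make $\nu$ noncrossing (well defined modulo 2). Wishart matrix: $G$ is a $dn\times dm$ matrix with independent complex $\mathcal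 N(0,1)$ entries (centered, $\mathbb E|G_{ij}|^2=1$), and $W=\frac{1}{dm}GG^*\in M_d(\mathbb C)\otimes M_n(\mathbb C)$, a $d\times d$ array of $n\times n$ blocks; $id\otimes\varphi$ applies $\varphi$ to each block. The asymptotic distribution of a random matrix $X=X_d$ is the collection of limits, as $d\to\infty$ with $n,m$ fixed, of the $*$-moments $(\mathbb E\circ tr)(X^{e_1}\cdots X^{e_p})$, $p\in\mathbb N$, $e_1,\ldots,e_p\in\{1,*\}$, with $tr$ the normalized trace. *)

(* Defs.v *)
From mathcomp Require Import all_boot all_order all_algebra.
From mathcomp Require Import perm boolp mxtens.

Set Implicit Arguments.
Unset Strict Implicit.
Unset Printing Implicit Defensive.

Import Order.TTheory GRing.Theory Num.Theory.

Local Open Scope ring_scope.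

Definition legs (k l : nat) : finType := ('I_k + 'I_l)%type.

Definition is_part (k l : nat) (nu : {set {set legs k l}}) : bool :=
  partition nu [set: legs k l].

Definition is_part_even (k l : nat) (nu : {set {set legs k l}}) : bool :=
  is_part nu && [forall B in nu, ~~ odd #|B|].

(* Position of a leg when the boundary of the diagram is read clockwise:
   upper row from left to right, then lower row from right to left. *)
Definition circ (k l : nat) (x : legs k l) : nat :=
  match x with
  | inl i => i
  | inr j => (k + rev_ord j)%N
  end.

Definition crossing (k l : nat) (nu : {set {set legs k l}}) : bool :=
  [exists B in nu, exists C in nu, (B != C) &&
    [exists x1 in B, exists y1 in C, exists x2 in B, exists y2 in C,
      [&& circ x1 < circ y1, circ y1 < circ x2 & circ x2 < circ y2]%N]].

Definition neighbors (k l : nat) (x y : legs k l) : bool :=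
  match x, y with
  | inl i, inl j => (j == i.+1 :> nat)
  | inr i, inr j => (j == i.+1 :> nat)
  | _, _ => false
  end.

Definition switch (k l : nat) (x y : legs k l) (nu : {set {set legs k l}}) :
    {set {set legs k l}} :=
  [set [set tperm x y z | z in B] | B : {set legs k l} in nu].

Fixpoint noncrossing_after (k l j : nat) (nu : {set {set legs k l}}) : bool :=
  if j is j'.+1 then
    [exists x, exists y,
      [&& neighbors x y, pblock nu x != pblock nu y
        & noncrossing_after j' (switch x y nu)]]
  else ~~ crossing nu.

(* The parity of the number of switches does not depend on the chosen sequence
   of switches when the blocks of [nu] have even size; the least number is used.
   Every partition can be made noncrossing, so the [else] value is not used. *)
Definition nb_switches (k l : nat) (nu : {set {set legs k l}}) : nat :=
  if pselect (exists j, noncrossing_after j nu) is left ex then ex_minn ex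
  else 0%N.

Definition signature (k l : nat) (nu : {set {set legs k l}}) : int :=
  (-1) ^+ nb_switches nu.

(* [nu <= p]: the blocks of [nu] are unions of blocks of [p]. *)
Definition merges (k l : nat) (nu p : {set {set legs k l}}) : bool :=
  [forall C in nu, C == \bigcup_(B in p | B \subset C) B].

Definition ker_part (k l n : nat) (f : legs k l -> 'I_n) :
    {set {set legs k l}} :=
  preim_partition f [set: legs k l].

Definition delta_part (k l n : nat) (p : {set {set legs k l}})
    (f : legs k l -> 'I_n) : bool :=
  [forall B in p, forall x in B, forall y in B, f x == f y].

(* The array with upper row [a c] and lower row [b d]. *)
Definition array (n : nat) (a c b d : 'I_n) (x : legs 2 2) : 'I_n :=
  match x with
  | inl i => if i == ord0 then a else c
  | inr j => if j == ord0 then b else d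
  end.

Definition crossing_pairing : {set {set legs 2 2}} :=
  [set [set (inl ord0 : legs 2 2); inr ord_max];
       [set (inl ord_max : legs 2 2); inr ord0]].

Definition phi (K : pzRingType) (n : nat) (p : {set {set legs 2 2}})
    (A : 'M[K]_n) : 'M[K]_n :=
  \sum_a \sum_c A a c *:
    (\sum_b \sum_d (delta_part p (array a c b d))%:R *: delta_mx b d).

Definition phibar (K : pzRingType) (n : nat) (p : {set {set legs 2 2}})
    (A : 'M[K]_n) : 'M[K]_n :=
  \sum_a \sum_c A a c *:
    (\sum_(nu : {set {set legs 2 2}} | is_part nu && merges nu p)
       (signature nu)%:~R *:
       (\sum_b \sum_(d | ker_part (array a c b d) == nu) delta_mx b d)).

Definition diag_part (K : pzRingType) (n : nat) (A : 'M[K]_n) : 'M[K]_n :=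
  diag_mx (\row_i A i i).

Definition block (K : pzRingType) (d n : nat) (W : 'M[K]_(d * n))
    (i j : 'I_d) : 'M[K]_n :=
  \matrix_(a, b) W (mxtens_index (i, a)) (mxtens_index (j, b)).

(* [id (x) f] on [M_d(K) (x) M_n(K)]. *)
Definition id_tens (K : pzRingType) (d n : nat) (f : 'M[K]_n -> 'M[K]_n)
    (W : 'M[K]_(d * n)) : 'M[K]_(d * n) :=
  \sum_i \sum_j tensmx (delta_mx i j : 'M[K]_d) (f (block W i j)).

From mathcomp Require Import all_classical all_reals all_analysis.
From mathcomp Require Import complex.

Import numFieldNormedType.Exports.

Local Open Scope complex_scope.
Local Open Scope classical_set_scope.

Definition mutually_independent (dT dU : measure_display)
    (T : measurableType dT) (U : measurableType dU) (R : realType)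
    (P : probability T R) (I : finType) (X : I -> T -> U) : Prop :=
  forall B : I -> set U, (forall i, measurable (B i)) ->
    P (\bigcap_(i in [set: I]) (X i @^-1` B i)) =
    (\prod_i P (X i @^-1` B i))%E.

(* Real variable with law [N(0, 1/2)]; the second parameter of [normal_prob]
   is the standard deviation. *)
Definition half_gaussian (dT : measure_display) (T : measurableType dT)
    (R : realType) (P : probability T R) (X : T -> R) : Prop :=
  measurable_fun [set: T] X /\
  forall B : set R, measurable B ->
    P (X @^-1` B) = normal_prob 0 (Num.sqrt 2^-1) B.

(* Complex [N(0, 1)]: independent real and imaginary parts of law [N(0, 1/2)]. *)
Definition complex_gaussian (dT : measure_display) (T : measurableType dT)
    (R : realType) (P : probability T R) (Z : T -> R[i]) : Prop :=
  [/\ half_gaussian P (fun t => complex.Re (Z t)),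
      half_gaussian P (fun t => complex.Im (Z t))
    & mutually_independent P
        (fun (b : bool) t => if b then complex.Im (Z t) else complex.Re (Z t))].

Definition complex_ginibre (dT : measure_display) (T : measurableType dT)
    (R : realType) (P : probability T R) (M N : nat)
    (G : T -> 'M[R[i]]_(M, N)) : Prop :=
  (forall i j, complex_gaussian P (fun t => G t i j)) /\
  mutually_independent P
    (fun (ij : 'I_M * 'I_N) t =>
       (complex.Re (G t ij.1 ij.2), complex.Im (G t ij.1 ij.2))).

Definition wishart (R : realType) (d n m : nat)
    (G : 'M[R[i]]_(d * n, d * m)) : 'M[R[i]]_(d * n) :=
  ((d * m)%:R)^-1 *: (G *m (G ^t*)%sesqui).

Definition cexpectation (dT : measure_display) (T : measurableType dT)
    (R : realType) (P : probability T R) (Z : T -> R[i]) : R[i] :=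
  fine ('E_P[fun t => complex.Re (Z t)]) +i*
  fine ('E_P[fun t => complex.Im (Z t)]).

Definition normalized_trace (R : realType) (N : nat) (X : 'M[R[i]]_N) : R[i] :=
  \tr X / N%:R.

(* In a word, [true] stands for the exponent [*] and [false] for [1]. *)
Definition star_word (R : realType) (N : nat) (X : 'M[R[i]]_N)
    (w : seq bool) : 'M[R[i]]_N :=
  \prod_(e <- w) (if e then (X ^t*)%sesqui else X).

Definition star_moment (dT : measure_display) (T : measurableType dT)
    (R : realType) (P : probability T R) (N : nat) (X : T -> 'M[R[i]]_N)
    (w : seq bool) : R[i] :=
  cexpectation P (fun t => normalized_trace (star_word (X t) w)).

Definition asymptotic_distribution (R : realType)
    (disp : nat -> measure_display) (T : forall d, measurableType (disp d))
    (P : forall d, probability (T d) R) (N : nat -> nat)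
    (X : forall d, T d -> 'M[R[i]]_(N d)) (mu : seq bool -> R[i]) : Prop :=
  forall w : seq bool,
    ((fun d => star_moment (P d) (X d) w) : nat -> (R[i])^o) @ \oo
      --> (mu w : (R[i])^o).

(* Main.v *)
(* Write [W] for the Wishart matrix. Both block-modified matrices have the
   entries [X (i,a) (j,b) = s a b * W (i,b) (j,a)], with [s = 1] for the
   untwisted map and [s a b = 1] or [-1] according to [a = b] or not for the
   twisted one; they are self-adjoint, so only the moments of [tr (X ^ p)]
   matter. By the Wick formula such a moment is a sum over the permutations
   [g] of the [p] factors, and with [c] the cyclic rotation the term of [g] is
   of order [d ^ (#cycles g + #cycles (c g) - p - 1)]. The exponent is never
   positive (genus inequality), so the limit keeps only the geodesic
   permutations, where it vanishes. The colourings [a] which contribute to [g]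
   satisfy [a o c = a o g]. When [g] is geodesic this forces [a o g o g = a],
   hence the number of positions where [a] and [a o g] differ is even, and all
   the signs of the twisted matrix cancel. *)
Require Import Defs.
From mathcomp Require Import all_boot all_order all_algebra.
From mathcomp Require Import fingroup perm.
From mathcomp Require Import all_classical all_reals all_analysis.
From mathcomp Require Import measurable_realfun.
From mathcomp Require Import complex mxtens.
From mathcomp Require Import ring lra zify.

Set Implicit Arguments.
Unset Strict Implicit.
Unset Printing Implicit Defensive.

Import Order.TTheory GRing.Theory Num.Theory.
Import numFieldNormedType.Exports.

Local Open Scope ring_scope.
Local Open Scope complex_scope.

(** * Permutations of genus zero *)

(** Why a geodesic [g] forces a o g o g = a: where [g] moves [x], multiply it by the transposition
    of [x] and [g x]. This cuts one cycle of [g] and, by equality in the genus inequality, splits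
    the cycle [c] in two. On the piece that contains [x], the points other than [x] are permuted by
    [g]; comparing how often each colour occurs there before and after one step of the cut cycle
    leaves a single equation between two colours. Without equality the signs need not cancel: for
    [g = c], three positions and three distinct colours, their product is -1. So the two matrices
    are compared only in the limit.

    For the Wick formula the obstacle is that laws and independence are given only as probabilities
    of measurable sets. Expectations of products are reached by exchanging one factor at a time with
    an indicator, and the one-dimensional moments by integrating a derivative. The formula itself is
    an integration by parts for linear forms in the real and imaginary parts, where 1 + i^2 = 0
    removes every pairing of two unconjugated entries. *)

Section Geodesic.
Local Open Scope nat_scope.
Variable T : finType.
Implicit Types (s g : {perm T}) (x y : T).
Local Open Scope group_scope.

(* Equality in [genus_le] below; when [g] is a full cycle, this means that the
   cycles of [s^-1] form a noncrossing partition. *)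
Definition geodesic s g := #|porbits s| + #|porbits (s * g)| == #|porbits g| + #|T|.

Lemma card_porbits_le s : #|porbits s| <= #|T|.
Proof. exact: leq_imset_card. Qed.

Lemma card_porbits1 : #|porbits (1 : {perm T})| = #|T|.
Proof.
rewrite card_imset // => x y /setP /(_ x); rewrite porbit_id => /esym/porbitP[k].
by rewrite expg1n perm1.
Qed.

(** The product fixes [x] and links its predecessor directly to [s x], so [x] leaves its cycle.
    Passing to inverses puts the transposition on the left, where [porbits_mul_tperm] counts. *)
Lemma card_porbits_cut s x : s x != x ->
  #|porbits (s * tperm x (s x))| = #|porbits s|.+1.
Proof.
move=> sx; rewrite -porbitsV invMg tpermV.
have := porbits_mul_tperm s^-1 x (s x).
rewrite porbitsV (eq_sym x) sx addn1.
by rewrite porbitV porbit_sym (mem_porbit s 1) /= addn0.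
Qed.

Lemma porbit_step s x : porbit s (s x) = porbit s x.
Proof. exact: (porbit_perm s 1). Qed.

Lemma mul_cutK s g x : (s * tperm x (s x)) * (tperm x (s x) * g) = s * g.
Proof. by rewrite mulgA -(mulgA s) tperm2 mulg1. Qed.

(** Each cut adds an orbit to [s], until [s = 1]. The hypothesis is granted for every second
    argument because the transposition cut off from [s] is absorbed by [g], the product staying the
    same ([mul_cutK]). *)
Lemma perm_cut_ind (P : {perm T} -> {perm T} -> Prop) :
  (forall g, P 1 g) ->
  (forall s g x, s x != x ->
     (forall h, P (s * tperm x (s x)) h) -> P s g) ->
  forall s g, P s g.
Proof.
move=> P1 PS s; have [k] := ubnP (#|T| - #|porbits s|).
elim: k s => // k IH s lek g.
case: (pickP (fun x => s x != x)) => [x sx|s1]; last first.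
  suff -> : s = 1 by [].
  by apply/permP => x; rewrite perm1; apply/eqP/negbFE/s1.
apply: (PS s g x sx); apply: IH.
have := card_porbits_le (s * tperm x (s x)).
by rewrite card_porbits_cut // => le; rewrite -ltnS (leq_trans _ lek) // ltnS ltn_sub2l.
Qed.

(** A cut adds one orbit to [s], keeps [s * g], and adds at most one orbit to the second factor. *)
Lemma genus_le s g : #|porbits s| + #|porbits (s * g)| <= #|porbits g| + #|T|.
Proof.
move: s g; apply: perm_cut_ind => [g|s g x sx /(_ (tperm x (s x) * g))].
  by rewrite mul1g card_porbits1 addnC.
rewrite mul_cutK card_porbits_cut //.
have := porbits_mul_tperm g x (s x); rewrite /= (eq_sym x) sx.
by case: (x \in _) => /=; lia.
Qed.

(** Equality leaves no slack: the transposition must split an orbit of [g], so [x] and [s x] share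
    an orbit before the cut and are separated after it. *)
Lemma geodesic_cut s g x : s x != x -> geodesic s g ->
  [/\ geodesic (s * tperm x (s x)) (tperm x (s x) * g), x \in porbit g (s x)
    & s x \notin porbit (tperm x (s x) * g) x].
Proof.
move=> sx /eqP /= geo.
have := genus_le (s * tperm x (s x)) (tperm x (s x) * g).
rewrite /geodesic mul_cutK card_porbits_cut //.
have := porbits_mul_tperm g x (s x); rewrite /= (eq_sym x) sx.
have := porbits_mul_tperm (tperm x (s x) * g) (s x) x.
rewrite /= (tpermC (s x)) mulgA tperm2 mul1g sx.
by case: (x \in _); case: (s x \in _) => /= H1 H2 H3; split => //; (try apply/eqP) => /=; lia.
Qed.

(** By cuts: the transposition preserves the orbits of [g], hence the orbits of the cut [g] lie
    inside those of [g]. *)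
Lemma geodesic_mem_porbit s g y : geodesic s g -> s y \in porbit g y.
Proof.
move: s g y; apply: perm_cut_ind => [g y _|s g x sx IH y geo].
  by rewrite perm1 porbit_id.
have [geo' xsx _] := geodesic_cut sx geo.
set t := tperm x (s x) in geo' *.
have tg z : t z \in porbit g z.
  rewrite /t; case: tpermP => [->|->|_ _] //; last exact: porbit_id.
  by rewrite porbit_sym.
have sub z i : ((t * g) ^+ i) z \in porbit g z.
  elim: i => [|i]; first by rewrite expg0 perm1 porbit_id.
  rewrite -!eq_porbit_mem => /eqP <-; rewrite expgSr !permM.
  by rewrite porbit_step eq_porbit_mem tg.
have -> : s y = t ((s * t) y) by rewrite -permM -mulgA tperm2 mulg1.
have /porbitP[k ->] := IH _ y geo'.
rewrite -eq_porbit_mem; have := tg (((t * g) ^+ k) y).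
by rewrite -eq_porbit_mem => /eqP ->; rewrite eq_porbit_mem.
Qed.

(** [s] will be the permutation of the Wick formula and [g] the rotation. On the orbit [O] of [x]
    under the cut [g], the cut [g] is a bijection of [O] and [s] is a bijection of [O] without [x];
    counting a value of [a] along [O] then leaves only the terms at [x]. *)
Lemma geodesic_alternate (V : eqType) s g (a : T -> V) : geodesic s g ->
  (forall x, a (g x) = a (s x)) -> forall x, a (s (s x)) = a x.
Proof.
move=> geo ags x; rewrite -ags.
have [sx|sx] := eqVneq (s x) x; first by rewrite ags !sx.
have [geo' _ sxNO] := geodesic_cut sx geo.
set t := tperm x (s x) in geo' sxNO.
pose O := porbit (t * g) x.
have sO y : y \in O -> (t * g) y \in O.
  by rewrite /O -!eq_porbit_mem porbit_step.
have tgx : (t * g) x = g (s x) by rewrite permM tpermL.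
have tgy y : y \in O -> y != x -> (t * g) y = g y.
  move=> yO yx; rewrite permM tpermD // 1?eq_sym //.
  by apply: contraNneq sxNO => <-.
(* The cut [s] stays in [O] by [geodesic_mem_porbit]. On points other than [x] it agrees with [s],
   except at the preimage of [x], which it sends to [s x]; as [s x] is not in [O], neither is that
   preimage. *)
have sy y : y \in O :\ x -> s y \in O :\ x.
  rewrite !inE => /andP[yx yO].
  have := geodesic_mem_porbit y geo'; rewrite -/t.
  have -> : porbit (t * g) y = O by apply/eqP; rewrite eq_porbit_mem.
  rewrite permM; have syx : s y != s x by rewrite (inj_eq perm_inj).
  have [syx'|syx'] := eqVneq (s y) x; first by rewrite syx' tpermL (negPf sxNO).
  by rewrite tpermD // eq_sym.
have imO : (t * g) @: O = O.
  apply/eqP; rewrite eqEcard card_imset ?leqnn ?andbT; last exact: perm_inj.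
  by apply/fintype.subsetP => _ /imsetP[y yO ->]; apply: sO.
have imOx : s @: (O :\ x) = O :\ x.
  apply/eqP; rewrite eqEcard card_imset ?leqnn ?andbT; last exact: perm_inj.
  by apply/fintype.subsetP => _ /imsetP[y yO ->]; apply: sy.
(* Counting the value [v] along the orbit [O] of the cut cycle, which starts at
   [g (s x)] and ends at [x]. *)
have cnt v : (a (g (s x)) == v) = (a x == v) :> nat.
  have xO : x \in O by exact: porbit_id.
  have : \sum_(y in O) (a ((t * g)%g y) == v) = \sum_(y in O) (a y == v).
    by rewrite -[in RHS]imO big_imset //= => y z _ _; apply: perm_inj.
  rewrite (bigD1 x) //= [RHS](bigD1 x) //= tgx.
  under eq_bigr => y /andP[yO yx] do rewrite tgy // ags.
  have -> : \sum_(y in O | y != x) (a (s y) == v) = \sum_(y in O | y != x) (a y == v).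
    have E (F : T -> nat) : \sum_(y in O | y != x) F y = \sum_(y in O :\ x) F y.
      by apply: eq_bigl => y; rewrite !inE andbC.
    rewrite !E -[in RHS]imOx big_imset //= => y z _ _; exact: perm_inj.
  by move/addIn.
by have := cnt (a x); rewrite eqxx; case: eqP.
Qed.

(** As a o s o s = a, [s] exchanges the ascents and the descents of [a], so the number of factors -1
    is twice the number of ascents. *)
Lemma geodesic_prod_sign (n : nat) (R : pzRingType) s g (a : T -> 'I_n) :
  geodesic s g -> (forall x, a (g x) = a (s x)) ->
  (\prod_x (if a x == a (g x) then 1 else -1) = 1 :> R)%R.
Proof.
move=> geo ags; have alt := geodesic_alternate geo ags.
under eq_bigr do rewrite ags.
rewrite (eq_bigr (fun x => (-1) ^+ (a x < a (s x)) * (-1) ^+ (a (s x) < a x)))%R; last first.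
  by move=> x _; rewrite -val_eqE /=; case: ltngtP; rewrite ?(mulr1, mul1r).
rewrite [LHS](_ : _ = (-1) ^+ (\sum_x ((a x < a (s x)) + (a (s x) < a x))))%R; last first.
  by elim/big_ind2: _ => [|x1 x2 y1 y2 -> ->|x _]; rewrite ?exprD.
rewrite big_split /= [X in (_ + X)%N](reindex_inj (@perm_inj _ s)) /=.
under [X in (_ + X)%N]eq_bigr do rewrite alt.
by rewrite addnn -mul2n exprM sqrrN !expr1n.
Qed.
End Geodesic.

(** * The partition of crossing pairs *)

Section CrossingPairing.
Let u0 : legs 2 2 := inl ord0.
Let u1 : legs 2 2 := inl ord_max.
Let l0 : legs 2 2 := inr ord0.
Let l1 : legs 2 2 := inr ord_max.

Lemma legs22P (x : legs 2 2) : [\/ x = u0, x = u1, x = l0 | x = l1].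
Proof.
case: x => -[[|[|//]] lti].
- by constructor 1; congr inl; apply: val_inj.
- by constructor 2; congr inl; apply: val_inj.
- by constructor 3; congr inr; apply: val_inj.
- by constructor 4; congr inr; apply: val_inj.
Qed.

(* Read clockwise, the legs are [u0], [u1], [l1], [l0]. *)
Lemma crossing22P (nu : {set {set legs 2 2}}) :
  reflect (exists B C, [/\ B \in nu, C \in nu, B != C, (u0 \in B) && (l1 \in B)
     & (u1 \in C) && (l0 \in C)]) (crossing nu).
Proof.
apply: (iffP idP).
  case/exists_inP => B BP /exists_inP[C CP /andP[BC]].
  case/exists_inP => x1 Bx1 /exists_inP[y1 Cy1] /exists_inP[x2 Bx2] /exists_inP[y2 Cy2] lt.
  exists B, C; split => //; move: Bx1 Cy1 Bx2 Cy2 lt.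
    by case: (legs22P x1) => ->; case: (legs22P y1) => ->; case: (legs22P x2) => -> //;
      case: (legs22P y2) => -> // -> _ ->.
  by case: (legs22P x1) => ->; case: (legs22P y1) => ->; case: (legs22P x2) => -> //;
      case: (legs22P y2) => -> // _ -> _ ->.
case=> B [C [Bnu Cnu BC /andP[Bu0 Bl1] /andP[Cu1 Cl0]]].
apply/exists_inP; exists B => //; apply/exists_inP; exists C => //; rewrite BC /=.
apply/exists_inP; exists u0 => //; apply/exists_inP; exists u1 => //.
by apply/exists_inP; exists l1 => //; apply/exists_inP; exists l0.
Qed.

(** The two crossing blocks must be {u0, l1} and {u1, l0}; they already cover all four legs. *)
Lemma crossing_part22 (nu : {set {set legs 2 2}}) :
  is_part nu -> crossing nu -> nu = crossing_pairing.
Proof.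
case/and3P => /eqP cov /finset.trivIsetP tI n0 /crossing22P[B [C [Bnu Cnu BC]]].
move=> /andP[Bu0 Bl1] /andP[Cu1 Cl0].
have /pred0P dBC := tI _ _ Bnu Cnu BC.
have BCF x : x \in B -> x \in C -> False.
  by move=> xB xC; have := dBC x; rewrite /= xB xC.
have BE : B = [set u0; l1].
  apply/setP => x; rewrite !inE; case: (legs22P x) => ->; rewrite ?Bu0 ?Bl1 ?eqxx ?orbT//.
  - by apply/negbTE/negP => /BCF; apply.
  - by apply/negbTE/negP => /BCF; apply.
have CE : C = [set u1; l0].
  apply/setP => x; rewrite !inE; case: (legs22P x) => ->; rewrite ?Cu1 ?Cl0 ?eqxx ?orbT//.
  - by apply/negbTE/negP; exact: BCF.
  - by apply/negbTE/negP; exact: BCF.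
rewrite /crossing_pairing -/u0 -/u1 -/l0 -/l1 -BE -CE.
apply/setP => D; rewrite !inE; apply/idP/orP => [Dnu|[] /eqP -> //].
have /finset.set0Pn[x Dx] : D != finset.set0 by apply: contraNneq n0 => <-.
have blk E : E \in nu -> x \in E -> D = E.
  move=> Enu xE; apply/eqP; apply: contraT => DE.
  by have /pred0P/(_ x) := tI _ _ Dnu Enu DE; rewrite /= Dx xE.
by case: (legs22P x) blk => -> blk; [left|right|right|left]; apply/eqP/blk.
Qed.

Lemma part_even_crossing_pairing : is_part_even crossing_pairing.
Proof.
rewrite /is_part_even /is_part; apply/andP; split; last first.
  by apply/forall_inP => B; rewrite !inE => /orP[] /eqP ->; rewrite cards2.
apply/and3P; split.
- apply/eqP/setP => x; rewrite !inE; apply/bigcupP.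
  by case: (legs22P x) => ->; [exists [set u0; l1]|exists [set u1; l0]|
    exists [set u1; l0]|exists [set u0; l1]]; rewrite !inE ?eqxx ?orbT.
- apply/finset.trivIsetP => B C; rewrite !inE => /orP[] /eqP -> /orP[] /eqP -> //;
    rewrite ?eqxx// => _;
    by apply/pred0P => x; rewrite /= !inE; case: (legs22P x) => ->.
- by rewrite !inE !(eq_sym finset.set0); apply/norP; split; apply/finset.set0Pn;
    [exists u0|exists u1]; rewrite !inE eqxx.
Qed.

Lemma crossing_crossing_pairing : crossing crossing_pairing.
Proof.
apply/crossing22P; exists [set u0; l1], [set u1; l0].
split; rewrite ?inE ?eqxx ?orbT//.
by apply/eqP => /setP/(_ u0); rewrite !inE.
Qed.

Lemma signature_noncrossing k l (nu : {set {set legs k l}}) :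
  ~~ crossing nu -> signature nu = 1.
Proof.
rewrite /signature /nb_switches => ncr; case: pselect => [ex|[]]; last by exists 0%N.
by case: ex_minnP => j _ /(_ 0%N ncr); rewrite leqn0 => /eqP ->.
Qed.

(** Zero switches do not suffice; exchanging the two upper legs turns both blocks into vertical
    pairs, so the least number is one. *)
Lemma signature_crossing_pairing : signature crossing_pairing = -1.
Proof.
have aft1 : noncrossing_after 1 crossing_pairing.
  apply/existsP; exists u0; apply/existsP; exists u1; apply/and3P; split => //.
    have /andP[/and3P[_ tI _] _] := part_even_crossing_pairing.
    rewrite (def_pblock (B := [set u0; l1]) tI) ?(def_pblock (B := [set u1; l0]) tI)
      ?inE ?eqxx ?orbT//.
    by apply/eqP => /setP/(_ u0); rewrite !inE.
  apply/crossing22P => -[B [C [/imsetP[B' B'cp ->] _ _ /andP[]]]].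
  rewrite -{1}(tpermR u0 u1) mem_imset; last exact: perm_inj.
  rewrite -{1}(@tpermD _ u0 u1 l1)// mem_imset; last exact: perm_inj.
  by move: B'cp; rewrite !inE => /orP[] /eqP ->; rewrite !inE.
rewrite /signature /nb_switches; case: pselect => [ex|[]]; last by exists 1%N.
case: ex_minnP => -[|[|j]] // H; last by move=> /(_ 1%N aft1).
by move: H; rewrite /= crossing_crossing_pairing.
Qed.

(** * Kernels of index arrays below the crossing pairing *)

Section Kernel.
Variables (n : nat) (f : legs 2 2 -> 'I_n).

Lemma is_part_ker : is_part (ker_part f).
Proof. exact: preim_partitionP. Qed.

Lemma mem_ker_part B x y : B \in ker_part f -> x \in B -> (y \in B) = (f x == f y).
Proof.
move=> Bk xB; have /and3P[_ tI _] := is_part_ker.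
rewrite -(def_pblock tI Bk xB) /ker_part /preim_partition pblock_equivalence_partition ?inE//.
by move=> a b c _ _ _; split => // /eqP ->.
Qed.

Lemma ker_part_block x : exists2 B, B \in ker_part f & x \in B.
Proof.
have /and3P[/eqP cov _ _] := is_part_ker.
have : x \in finset.cover (ker_part f) by rewrite cov inE.
by case/bigcupP => B; exists B.
Qed.

Lemma merges_ker_crossing_pairing :
  merges (ker_part f) crossing_pairing = (f u0 == f l1) && (f u1 == f l0).
Proof.
apply/forall_inP/andP => [mg|[/eqP ful /eqP flu] C Ck].
  have mem x : exists B, [/\ B \in crossing_pairing, x \in B & forall y, y \in B -> f x == f y].
    have [C Ck xC] := ker_part_block x.
    have := xC; rewrite {1}(eqP (mg _ Ck)) => /bigcupP[B /andP[Bcp /fintype.subsetP BC] xB].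
    by exists B; split => // y /BC; rewrite (mem_ker_part _ Ck xC).
  split.
    have [B [/[!inE]/orP[]/eqP ->]] := mem u0; rewrite !inE// => _; apply.
    by rewrite !inE eqxx orbT.
  have [B [/[!inE]/orP[]/eqP ->]] := mem u1; rewrite !inE// => _; apply.
  by rewrite !inE eqxx orbT.
apply/eqP/setP => x; apply/idP/bigcupP => [xC|[B /andP[_ /fintype.subsetP BC] /BC] //].
have E y := mem_ker_part y Ck xC.
case: (legs22P x) xC E => -> xC E; [exists [set u0; l1]|exists [set u1; l0]|
  exists [set u1; l0]|exists [set u0; l1]]; rewrite ?inE ?eqxx ?orbT//=;
  by apply/fintype.subsetP => y; rewrite !inE => /orP[] /eqP ->; rewrite E ?ful ?flu.
Qed.

(** The only candidates are the pairing itself and the one-block partition, told apart by whether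
    the two upper indices agree. *)
Lemma signature_ker : merges (ker_part f) crossing_pairing ->
  signature (ker_part f) = if f u0 == f u1 then 1 else -1.
Proof.
rewrite merges_ker_crossing_pairing => /andP[ful flu]; case: ifPn => [fuu|fuu].
  apply: signature_noncrossing; apply/crossing22P => -[B [C [Bk Ck BC /andP[Bu0 _] /andP[Cu1 _]]]].
  move/negP: BC; apply; apply/eqP/setP => x.
  by rewrite (mem_ker_part x Bk Bu0) (mem_ker_part x Ck Cu1) (eqP fuu).
rewrite [ker_part f](crossing_part22 is_part_ker) ?signature_crossing_pairing//.
have [B Bk Bu0] := ker_part_block u0; have [C Ck Cu1] := ker_part_block u1.
apply/crossing22P; exists B, C; split => //.
- apply: contraNneq fuu => BC; move: Cu1; rewrite -BC.
  by rewrite (mem_ker_part _ Bk Bu0).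
- by rewrite Bu0 (mem_ker_part _ Bk Bu0).
- by rewrite Cu1 (mem_ker_part _ Ck Cu1).
Qed.
End Kernel.

Lemma phi_crossing (K : pzRingType) n (A : 'M[K]_n) : phi crossing_pairing A = A^T.
Proof.
have E a c : \sum_b \sum_d' (delta_part crossing_pairing (array a c b d'))%:R *: delta_mx b d' =
    delta_mx c a :> 'M[K]_n.
  have dl b d' : delta_part crossing_pairing (array a c b d') = (b == c) && (d' == a).
    apply/forall_inP/andP => [H|[/eqP -> /eqP ->] B].
      have H' B x y : B \in crossing_pairing -> x \in B -> y \in B ->
          array a c b d' x == array a c b d' y.
        by move=> Bcp xB yB; have /forall_inP/(_ x xB)/forall_inP/(_ y yB) := H B Bcp.
      split.
        by apply: (H' [set u1; l0] l0 u1); rewrite !inE eqxx ?orbT.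
      by apply: (H' [set u0; l1] l1 u0); rewrite !inE eqxx ?orbT.
    by rewrite !inE => /orP[] /eqP ->; apply/forall_inP => x; rewrite !inE => /orP[] /eqP ->;
      apply/forall_inP => y; rewrite !inE => /orP[] /eqP ->.
  rewrite (bigD1 c)//= [X in _ + X]big1 ?addr0 => [|b bc]; last first.
    by apply: big1 => d' _; rewrite dl (negPf bc) scale0r.
  rewrite (bigD1 a)//= [X in _ + X]big1 ?addr0 => [|b ba]; last first.
    by rewrite dl (negPf ba) andbF scale0r.
  by rewrite dl !eqxx scale1r.
rewrite /phi; under eq_bigr do under eq_bigr do rewrite E.
rewrite [RHS]matrix_sum_delta exchange_big; apply: eq_bigr => c _; apply: eq_bigr => a _.
by rewrite mxE.
Qed.

(** For a given array a single [nu] can contribute, its kernel. The entrywise form, a sign times a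
    transposed entry, is what makes both maps instances of [twist]. *)
Lemma phibar_crossingE (K : pzRingType) n (A : 'M[K]_n) i j :
  phibar crossing_pairing A i j = (if i == j then 1 else -1) * A j i.
Proof.
have E a c : \sum_(nu : {set {set legs 2 2}} | is_part nu && merges nu crossing_pairing)
       (signature nu)%:~R *:
       (\sum_b \sum_(d' | ker_part (array a c b d') == nu) delta_mx b d') =
    (if a == c then 1 else -1) *: delta_mx c a :> 'M[K]_n.
  transitivity (\sum_b \sum_d' \sum_(nu | [&& is_part nu, merges nu crossing_pairing
      & ker_part (array a c b d') == nu]) (signature nu)%:~R *: delta_mx b d' : 'M[K]_n).
    under eq_bigr do rewrite scaler_sumr.
    rewrite exchange_big; apply: eq_bigr => b _ /=.
    under eq_bigr do rewrite scaler_sumr big_mkcond /=.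
    rewrite exchange_big; apply: eq_bigr => d' _ /=.
    rewrite -big_mkcondr /=; apply: eq_bigl => nu; by rewrite andbA.
  have inner b d' : \sum_(nu | [&& is_part nu, merges nu crossing_pairing
      & ker_part (array a c b d') == nu]) (signature nu)%:~R *: delta_mx b d' =
      (if (b == c) && (d' == a) then if a == c then 1 else -1 else 0) *: delta_mx b d' :> 'M[K]_n.
    rewrite (eq_bigl (fun nu => merges (ker_part (array a c b d')) crossing_pairing
        && (nu == ker_part (array a c b d')))); last first.
      move=> nu; rewrite [ker_part _ == nu]eq_sym.
      by case: (eqVneq nu) => [->|_]; rewrite ?andbF ?andbT ?is_part_ker.
    rewrite big_mkcondl big_pred1_eq /= merges_ker_crossing_pairing /= andbC eq_sym [d' == _]eq_sym.
    case: ifPn => [mg|_]; last by rewrite scale0r.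
    rewrite signature_ker ?merges_ker_crossing_pairing 1?andbC 1?eq_sym//=.
    by case: ifP => _; rewrite ?mulrN1z ?mulr1z.
  under eq_bigr do under eq_bigr do rewrite inner.
  rewrite (bigD1 c)//= [X in _ + X]big1 ?addr0 => [|b bc]; last first.
    by apply: big1 => d' _; rewrite (negPf bc) scale0r.
  rewrite (bigD1 a)//= [X in _ + X]big1 ?addr0 => [|b ba]; last first.
    by rewrite (negPf ba) andbF scale0r.
  by rewrite !eqxx.
rewrite /phibar; under eq_bigr do under eq_bigr do rewrite E.
rewrite summxE (bigD1 j)//= [X in _ + X]big1 ?addr0 => [|a aj]; last first.
  by rewrite summxE big1// => c _; rewrite !mxE (eq_sym j) (negPf aj) andbF !mulr0.
rewrite summxE (bigD1 i)//= [X in _ + X]big1 ?addr0 => [|c ci]; last first.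
  by rewrite !mxE (eq_sym i) (negPf ci) !mulr0.
by rewrite !mxE !eqxx mulr1 (eq_sym j); case: ifP => _; rewrite ?mulrN1 ?mulr1 ?mulN1r ?mul1r.
Qed.

Lemma phibar_crossing (K : pzRingType) n (A : 'M[K]_n) :
  phibar crossing_pairing A = diag_part A *+ 2 - A^T.
Proof.
apply/matrixP => i j; rewrite phibar_crossingE !mxE.
have [->|_] := eqVneq i j; first by rewrite mul1r mulr1n addrK.
by rewrite mulN1r mulr0n add0r sub0r.
Qed.
End CrossingPairing.

(** * Change of variables and independence *)

Section SimpleApproximation.
Local Open Scope classical_set_scope.
Local Open Scope ring_scope.
Local Open Scope complex_scope.
Local Open Scope ereal_scope.
Import HBNNSimple.

(** Simple approximations of [f] show that the integral depends on [X] and [h] only through the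
    masses of [h] on preimages under [X]. The weight [h] serves both for a change of density and for
    a product with further factors. *)
Lemma ge0_integral_compM_lim (d d' : measure_display) (T : measurableType d)
    (U : measurableType d') (R : realType) (mu : {measure set T -> \bar R})
    (X : T -> U) (h : T -> R) (f : U -> R)
    (mf : measurable_fun [set: U] (EFin \o f : U -> \bar R)) :
  measurable_fun [set: T] X -> measurable_fun [set: T] h ->
  (forall x, 0 <= h x)%R -> (forall u, 0 <= f u)%R ->
  \int[mu]_x (f (X x) * h x)%:E =
  limn (fun n => \sum_(r \in range (nnsfun_approx measurableT mf n))
     r%:E * \int[mu]_(x in X @^-1` (nnsfun_approx measurableT mf n @^-1` [set r])) (h x)%:E).
Proof.
move=> mX mh h0 f0; set g := nnsfun_approx measurableT mf.
have mgX n : measurable_fun [set: T] (g n \o X) by exact: measurableT_comp.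
transitivity (limn (fun n => \int[mu]_x (g n (X x) * h x)%:E)).
  rewrite -monotone_convergence//.
  - apply: eq_integral => x _; apply/esym/cvg_lim => //.
    under eq_fun do rewrite EFinM; rewrite EFinM.
    apply: cvgeZr => //.
    by apply: (cvg_nnsfun_approx measurableT mf) => // u _; rewrite lee_fin.
  - by move=> n; apply/measurable_EFinP/(measurable_funM (mgX n)).
  - by move=> n x _; rewrite lee_fin mulr_ge0.
  - move=> x _ m n mn; rewrite lee_fin ler_wpM2r//.
    exact/lefP/nd_nnsfun_approx.
congr (limn _); apply/funext => n.
have mA r : measurable (X @^-1` (g n @^-1` [set r])).
  by rewrite -[X in measurable X]setTI; apply: mX.
transitivity (\int[mu]_x \sum_(r \in range (g n)) (r * \1_(g n @^-1` [set r]) (X x) * h x)%:E).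
  apply: eq_integral => x _; rewrite fsumEFin//; congr EFin.
  by rewrite fimfunE -mulr_fsuml.
rewrite ge0_integral_fsum//.
- apply: eq_fsbigr => r /[!inE] -[u _ <-].
  under eq_integral do rewrite -mulrA EFinM.
  rewrite ge0_integralZl//; last 3 first.
  + apply/measurable_EFinP/measurable_funM => //.
    by apply: (@measurableT_comp _ _ _ _ _ _ (\1_(g n @^-1` [set g n u]) : U -> R) _ X).
  + by move=> x _; rewrite lee_fin mulr_ge0.
  + by rewrite lee_fin.
  congr (_ * _); rewrite [RHS]integral_mkcond; apply: eq_integral => x _.
  rewrite patchE indicE.
  have -> : (X x \in g n @^-1` [set g n u]) = (x \in X @^-1` (g n @^-1` [set g n u])).
    by apply/idP/idP; rewrite !inE.
  by case: ifP; rewrite ?mul1r// mul0r.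
- move=> r; apply/measurable_EFinP/measurable_funM => //.
  apply: measurable_funM => //.
  by apply: (@measurableT_comp _ _ _ _ _ _ (\1_(g n @^-1` [set r]) : U -> R) _ X).
- by move=> r x _; rewrite EFinM mule_ge0 ?lee_fin// -lee_fin nnfun_muleindic_ge0.
Qed.

End SimpleApproximation.

(** * Transfer of integrals between weighted measures with the same image *)

Section IntegralTransfer.
Local Open Scope classical_set_scope.
Local Open Scope ring_scope.
Local Open Scope complex_scope.
Import HBNNSimple.
Local Open Scope ereal_scope.
Variables (d1 d2 d : measure_display) (T1 : measurableType d1) (T2 : measurableType d2)
    (U : measurableType d) (R : realType).
Variables (mu1 : {measure set T1 -> \bar R}) (mu2 : {measure set T2 -> \bar R})
    (X : T1 -> U) (Y : T2 -> U) (h : T1 -> R) (k : T2 -> R).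
Hypotheses (mX : measurable_fun [set: T1] X) (mY : measurable_fun [set: T2] Y)
  (mh : measurable_fun [set: T1] h) (mk : measurable_fun [set: T2] k).
Hypotheses (h0 : forall x, (0 <= h x)%R) (k0 : forall y, (0 <= k y)%R).
Hypothesis hk : forall B, measurable B ->
  \int[mu1]_(x in X @^-1` B) (h x)%:E = \int[mu2]_(y in Y @^-1` B) (k y)%:E.

Lemma ge0_integral_transfer (f : U -> R) : measurable_fun [set: U] f ->
  (forall u, 0 <= f u)%R ->
  \int[mu1]_x (f (X x) * h x)%:E = \int[mu2]_y (f (Y y) * k y)%:E.
Proof.
move=> /measurable_EFinP mf f0.
rewrite (ge0_integral_compM_lim mu1 mf)// (ge0_integral_compM_lim mu2 mf)//.
congr (limn _); apply/funext => n; apply: eq_fsbigr => r _.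
by rewrite hk//; exact: measurable_funPTI.
Qed.

(** The weights are nonnegative, so the positive and negative parts of the integrands are those of
    [f] times the weight. *)
Lemma integral_transfer (f : U -> R) : measurable_fun [set: U] f ->
  \int[mu1]_x (f (X x) * h x)%:E = \int[mu2]_y (f (Y y) * k y)%:E.
Proof.
move=> mf.
have mp : measurable_fun [set: U] (fun u => Num.max (f u) 0%R).
  exact: measurable_maxr.
have mn : measurable_fun [set: U] (fun u => Num.max (- f u)%R 0%R).
  by apply: measurable_maxr => //; exact: measurableT_comp.
rewrite integralE [RHS]integralE; congr (_ - _).
- transitivity (\int[mu1]_x (Num.max (f (X x)) 0%R * h x)%:E).
    apply: eq_integral => x _.
    by rewrite funeposE -EFin_max maxr_pMl// mul0r.
  rewrite (ge0_integral_transfer mp)//; last by move=> u; rewrite le_max lexx orbT.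
  by apply: eq_integral => x _; rewrite funeposE -EFin_max maxr_pMl// mul0r.
- transitivity (\int[mu1]_x (Num.max (- f (X x))%R 0%R * h x)%:E).
    apply: eq_integral => x _.
    by rewrite funenegE -EFinN -EFin_max maxr_pMl// mul0r mulNr.
  rewrite (ge0_integral_transfer mn)//; last by move=> u; rewrite le_max lexx orbT.
  by apply: eq_integral => x _; rewrite funenegE -EFinN -EFin_max maxr_pMl// mul0r mulNr.
Qed.

Lemma integrable_transfer (f : U -> R) : measurable_fun [set: U] f ->
  mu2.-integrable [set: T2] (fun y => (f (Y y) * k y)%:E) ->
  mu1.-integrable [set: T1] (fun x => (f (X x) * h x)%:E).
Proof.
move=> mf /integrableP[_ fin]; apply/integrableP; split.
  by apply/measurable_EFinP/measurable_funM => //; exact: measurableT_comp.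
under eq_integral do rewrite abse_EFin normrM (ger0_norm (h0 _)).
have mf' : measurable_fun [set: U] (fun u => `|f u|)%R by exact: measurableT_comp.
rewrite (ge0_integral_transfer mf')//; apply: le_lt_trans fin.
by under [X in _ <= X]eq_integral do rewrite abse_EFin normrM (ger0_norm (k0 _)).
Qed.
End IntegralTransfer.

(** * Expectation of a product of independent variables *)

Section Independence.
Local Open Scope classical_set_scope.
Local Open Scope ring_scope.
Local Open Scope complex_scope.
Local Open Scope ereal_scope.
Variables (dT dU : measure_display) (T : measurableType dT) (U : measurableType dU)
  (R : realType) (P : probability T R) (I : finType) (X : I -> T -> U).
Hypotheses (mX : forall i, measurable_fun [set: T] (X i))
  (indX : mutually_independent P X).

Lemma measurable_prod_comp (Q : pred I) (F : I -> U -> R) :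
  (forall i, measurable_fun [set: U] (F i)) ->
  measurable_fun [set: T] (fun t => \prod_(i | Q i) F i (X i t))%R.
Proof.
move=> mF; under eq_fun do rewrite -big_filter.
by apply: measurable_prod => i _; exact: measurableT_comp.
Qed.

Lemma ge0_integral_prod_indep (F : I -> U -> R) (m : I -> R) :
  (forall i, measurable_fun [set: U] (F i)) ->
  (forall i u, 0 <= F i u)%R ->
  (forall i, \int[P]_t (F i (X i t))%:E = (m i)%:E) ->
  \int[P]_t (\prod_i F i (X i t))%:E = (\prod_i m i)%:E.
Proof.
(* Generalised for induction: outside the list [s] the factors are indicators. The empty list is the
   definition of independence; the inductive step frees one index [j]. *)
suff H (s : seq I) (G : I -> U -> R) (k : I -> R) : (forall i, measurable_fun [set: U] (G i)) ->
  (forall i u, 0 <= G i u)%R ->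
  (forall i, i \notin s -> exists2 B, measurable B & G i = \1_B) ->
  (forall i, \int[P]_t (G i (X i t))%:E = (k i)%:E) ->
  \int[P]_t (\prod_i G i (X i t))%:E = (\prod_i k i)%:E.
  move=> mF F0 Fm; apply: (H (enum I)) => // i; by rewrite mem_enum.
elim: s G k => [|j s IH] G k mG G0 indG Gk.
  have /choice[B HB] : forall i, exists B, measurable B /\ G i = \1_B.
    by move=> i; have [//|B mB GB] := indG i; exists B.
  have {}HB i := HB i.
  rewrite [RHS](big_morph EFin EFinM erefl).
  transitivity (P (\bigcap_(i in [set: I]) (X i @^-1` B i))).
    rewrite -[RHS]mul1e -integral_cst//; last first.
      apply: fin_bigcap_measurable => // i _; rewrite -[X in measurable X]setTI.
      by apply: mX => //; case: (HB i).
    rewrite [RHS]integral_mkcond; apply: eq_integral => t _.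
    rewrite patchE; case: ifPn => [|/negP].
      rewrite inE /bigcap /= => tB; congr EFin.
      by apply: big1 => i _; rewrite (HB i).2 indicE mem_set//; apply: tB.
    rewrite inE => /existsNP[i /not_implyP[_ tB]].
    by rewrite (bigD1 i)//= (HB i).2 indicE memNset// mul0r.
  rewrite indX; last by move=> i; case: (HB i).
  apply: eq_bigr => i _; rewrite -Gk (HB i).2.
  rewrite [RHS](@integral_indic _ _ _ P setT measurableT (X i @^-1` B i)) ?setIT//.
  by rewrite -[X in measurable X]setTI; apply: mX => //; case: (HB i).
have mGj B : measurable B -> measurable (X j @^-1` B).
  by move=> mB; rewrite -[X in measurable X]setTI; exact: mX.
have k0 i : (0 <= k i)%R.
  by rewrite -lee_fin -Gk integral_ge0// => t _; rewrite lee_fin.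
pose c := (\prod_(i | i != j) k i)%R.
have c0 : (0 <= c)%R by apply: prodr_ge0.
under eq_integral do rewrite (bigD1 j)//=.
(* The weight of [X j] is the product of the other factors on one side and the constant [c] on the
   other. Over the preimage of a set [B] both have the same mass, by the induction hypothesis with
   [G j] replaced by the indicator of [B]. *)
rewrite (@ge0_integral_transfer _ _ _ _ _ _ _ P P (X j) (X j) _ (cst c))//=.
- under eq_integral do rewrite EFinM muleC.
  rewrite ge0_integralZl_EFin//; last 2 first.
  + by move=> t _; rewrite lee_fin.
  + by apply/measurable_EFinP; exact: measurableT_comp.
  by rewrite Gk -EFinM mulrC [in RHS](bigD1 j).
- exact: measurable_prod_comp.
- by move=> t; apply: prodr_ge0.
- move=> B mB.
  rewrite integral_cst; last exact: mGj.
  pose G' i := if i == j then \1_B else G i : U -> R.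
  pose k' i := if i == j then fine (P (X j @^-1` B)) else k i.
  transitivity (\int[P]_t (\prod_i G' i (X i t))%:E).
    rewrite integral_mkcond; apply: eq_integral => t _.
    rewrite patchE [in RHS](bigD1 j)//= /G' eqxx indicE.
    have -> : (X j t \in B) = (t \in X j @^-1` B) by apply/idP/idP; rewrite !inE.
    case: ifP => _; rewrite ?mul0r// mul1r; congr EFin.
    by apply: eq_bigr => i /negPf ->.
  rewrite (IH G' k'); first last.
  + move=> i; rewrite /G' /k'; case: ifPn => [/eqP ->|_]; last exact: Gk.
    rewrite (@integral_indic _ _ _ P setT measurableT (X j @^-1` B))//; last exact: mGj.
    by rewrite setIT fineK// fin_num_measure//; exact: mGj.
  + move=> i ins; rewrite /G'; case: ifPn => [_|ij]; first by exists B.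
    by apply: indG; rewrite inE negb_or ij.
  + by move=> i u; rewrite /G'; case: ifPn.
  + by move=> i; rewrite /G'; case: ifPn => // _; exact: measurable_indic.
  rewrite (bigD1 j)//= /k' eqxx mulrC EFinM fineK; last first.
    by rewrite fin_num_measure//; exact: mGj.
  by congr (_%:E * _); apply: eq_bigr => i /negPf ->.
Qed.

(** Each factor is a difference of nonnegative parts; [phi] chooses one part per factor, which
    reduces to the nonnegative case. *)
Lemma integral_prod_indep (F : I -> U -> R) (m : I -> R) :
  (forall i, measurable_fun [set: U] (F i)) ->
  (forall i, P.-integrable [set: T] (fun t => (F i (X i t))%:E)) ->
  (forall i, \int[P]_t (F i (X i t))%:E = (m i)%:E) ->
  P.-integrable [set: T] (fun t => (\prod_i F i (X i t))%:E) /\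
  \int[P]_t (\prod_i F i (X i t))%:E = (\prod_i m i)%:E.
Proof.
move=> mF iF Fm.
have fin f : P.-integrable [set: T] (EFin \o f) -> (forall t, 0 <= f t)%R ->
    exists r, \int[P]_t (f t)%:E = r%:E.
  move=> /integrable_fin_num - /(_ measurableT) fin f0.
  by exists (fine (\int[P]_t (f t)%:E)); rewrite fineK.
pose G i (b : bool) u := Num.max (if b then - F i u else F i u)%R 0%R.
have mG i b : measurable_fun [set: U] (G i b).
  by apply: measurable_maxr => //; case: b => //; exact: measurableT_comp.
have G0 i b u : (0 <= G i b u)%R by rewrite le_max lexx orbT.
have iG i b : P.-integrable [set: T] (fun t => (G i b (X i t))%:E).
  apply: le_integrable (iF i) => //.
    by apply/measurable_EFinP; exact: measurableT_comp.
  move=> t _; rewrite !abse_EFin lee_fin ger0_norm// /G ge_max normr_ge0 andbT.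
  by case: b; rewrite ?ler_norm// -normrN ler_norm.
have /choice[k kG] : forall ib : I * bool, exists r,
    \int[P]_t (G ib.1 ib.2 (X ib.1 t))%:E = r%:E.
  by move=> [i b]; apply: fin => //; exact: iG.
have GF i u : (F i u = \sum_(b : bool) (-1) ^+ b * G i b u)%R.
  rewrite big_bool /= /G expr1 expr0.
  by case: (leP (F i u) 0%R) => h; case: (leP (- F i u)%R 0%R) => h'; lra.
pose Z (phi : {ffun I -> bool}) t := (\prod_i ((-1) ^+ phi i * G i (phi i) (X i t)))%R.
have FZ t : (\prod_i F i (X i t) = \sum_phi Z phi t)%R.
  by under eq_bigr do rewrite GF; rewrite bigA_distr_bigA.
have sgnM (phi : {ffun I -> bool}) (f : I -> R) :
    (\prod_i ((-1) ^+ phi i * f i) = (\prod_i (-1) ^+ phi i) * \prod_i f i)%R.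
  by rewrite big_split.
have kZ (phi : {ffun I -> bool}) : \int[P]_t (\prod_i G i (phi i) (X i t))%:E
    = (\prod_i k (i, phi i))%:E.
  apply: (ge0_integral_prod_indep (F := fun i => G i (phi i))) => // i.
  by rewrite (kG (i, phi i)).
have iZ' (phi : {ffun I -> bool}) :
    P.-integrable [set: T] (fun t => (\prod_i G i (phi i) (X i t))%:E).
  apply/integrableP; split.
    apply/measurable_EFinP.
    exact: (@measurable_prod_comp predT (fun i => G i (phi i))).
  under eq_integral do rewrite abse_EFin ger0_norm ?prodr_ge0//.
  by rewrite kZ ltry.
have iZ phi : P.-integrable [set: T] (fun t => (Z phi t)%:E).
  under eq_fun do rewrite /Z sgnM EFinM.
  exact: integrableZl.
split.
  under eq_fun do rewrite FZ -sumEFin.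
  exact: integrable_sum.
under eq_integral do rewrite FZ -sumEFin.
rewrite integral_sum//.
have -> : (\prod_i m i = \prod_i \sum_(b : bool) (-1) ^+ b * k (i, b))%R.
  apply: eq_bigr => i _; apply: EFin_inj; rewrite -Fm.
  under eq_integral do rewrite GF -sumEFin.
  rewrite integral_sum// => [|b]; last first.
    by under eq_fun do rewrite EFinM; exact: integrableZl.
  rewrite -sumEFin; apply: eq_bigr => b _.
  under eq_integral do rewrite EFinM.
  by rewrite integralZl// (kG (i, b)).
rewrite bigA_distr_bigA -sumEFin; apply: eq_bigr => phi _.
under eq_integral do rewrite /Z sgnM EFinM.
by rewrite integralZl// kZ sgnM EFinM.
Qed.
End Independence.

(** * Gaussian moments *)

Section GaussianMoments.
Local Open Scope classical_set_scope.
Local Open Scope ring_scope.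
Local Open Scope complex_scope.
Variable R : realType.
Local Notation mu := (@lebesgue_measure R).

(** The fundamental theorem of calculus on [-n, n], then dominated convergence with the absolute
    value of [f] as bound. *)
Lemma integral_derivative_vanishing (F f : R -> R) :
  (forall x : R, is_derive x (1 : R) F (f x)) -> continuous f ->
  mu.-integrable [set: R] (EFin \o f) ->
  F n%:R @[n --> \oo] --> (0 : R) -> F (- n%:R) @[n --> \oo] --> (0 : R) ->
  (\int[mu]_x (f x)%:E = 0)%E.
Proof.
move=> dF cf intf Fy FNy.
have cF x : {for x, continuous F}.
  by apply: differentiable_continuous; apply/derivable1_diffP; case: (dF x).
pose D n : set R := `[- n%:R, n%:R]%classic.
(* [n.+1] keeps the interval nondegenerate, as the fundamental theorem requires. *)
have intD n : (\int[mu]_(x in D n.+1) (f x)%:E = (F n.+1%:R - F (- n.+1%:R))%:E)%E.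
  rewrite EFinB; apply: continuous_FTC2.
  - by rewrite -subr_gt0 opprK addr_gt0.
  - by apply: continuous_subspaceT.
  - split.
    + by move=> x _; case: (dF x).
    + exact/cvg_at_right_filter/cF.
    + exact/cvg_at_left_filter/cF.
  - by move=> x _; rewrite derive1E; case: (dF x).
have := @dominated_convergence _ _ R mu setT measurableT
    (fun n => (EFin \o f) \_ (D n.+1)) (EFin \o f) (abse \o (EFin \o f)).
have mf : measurable_fun [set: R] (EFin \o f) by case/integrableP: intf.
have H1 n : measurable_fun [set: R] ((EFin \o f) \_ (D n.+1)).
  by apply/(measurable_restrictT _ (measurable_itv _)); exact: measurable_funTS.
have H2 : {ae mu, forall x, [set: R] x ->
    ((EFin \o f) \_ (D n.+1)) x @[n --> \oo] --> (EFin \o f) x}.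
  apply: aeW => x _.
  apply: cvg_near_cst; near=> N; rewrite patchE mem_set// /D /= in_itv /= -ler_norml.
  apply: (@le_trans _ _ N%:R); last by rewrite ler_nat.
  by near: N; exact: nbhs_infty_ger.
have H3 : {ae mu, forall x n, [set: R] x ->
    (`|((EFin \o f) \_ (D n.+1)) x| <= (abse \o (EFin \o f)) x)%E}.
  apply: aeW => x n _; rewrite patchE.
  by case: ifP => _; [exact: lexx|rewrite abse0; exact: abse_ge0].
move=> /(_ H1 mf H2 (integrable_abse intf) H3)[_ _ cvg1].
have cvg2 : (\int[mu]_(x in D n.+1) (f x)%:E)%E @[n --> \oo] --> 0%E.
  under eq_fun do rewrite intD.
  apply: cvg_EFin; first exact: nearW.
  rewrite -[0]subr0; apply: (@cvgB _ R^o).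
    by rewrite (cvg_shiftS (fun n => F n%:R)).
  by rewrite (cvg_shiftS (fun n => F (- n%:R))).
have E : (fun n => \int[mu]_(x in D n.+1) (f x)%:E)%E =
    (fun n => \int[mu]_x ((EFin \o f) \_ (D n.+1)) x)%E.
  by apply/funext => n; rewrite integral_mkcond.
by rewrite E in cvg2; exact: (cvg_unique _ cvg1 cvg2).
Unshelve. all: by end_near. Qed.

(** Half of the exponent absorbs the power: with [y = x^2 / 2], |x|^k <= 1 + x^(2k) = 1 + 2^k y^k
    and y^k <= k! exp y. What remains is a standard Gaussian, which gives both integrability and
    decay. *)
Lemma normr_expX_gauss_le k (x : R) :
  `|x| ^+ k * expR (- x ^+ 2) <= (1 + 2 ^+ k * k`!%:R) * expR (- x ^+ 2 / 2).
Proof.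
pose y := x ^+ 2 / 2.
have y0 : 0 <= y by rewrite divr_ge0 ?sqr_ge0.
have -> : expR (- x ^+ 2) = expR (- x ^+ 2 / 2) * expR (- y).
  by rewrite -expRD; congr expR; rewrite /y; field.
rewrite mulrCA mulrC ler_wpM2r ?expR_ge0//.
rewrite expRN ler_pdivrMr ?expR_gt0//.
have xk : `|x| ^+ k <= 1 + (x ^+ 2) ^+ k.
  rewrite -real_normK ?num_real// -exprM mulnC exprM.
  have := sqr_ge0 (`|x| ^+ k - 1); set z := `|x| ^+ k; nra.
apply: le_trans xk _.
have yk : y ^+ k <= k`!%:R * expR y.
  case: k => [|k]; first by rewrite expr0 fact0 mul1r -expR0 ler_expR.
  have := expR_ge1Dxn k y0; rewrite -ler_pdivrMl ?ltr0n ?fact_gt0//.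
  by rewrite mulrC; lra.
have -> : x ^+ 2 = 2 * y by rewrite /y; field.
rewrite exprMn mulrDl mul1r -mulrA lerD//; first by rewrite -expR0 ler_expR.
by rewrite ler_wpM2l// exprn_ge0.
Qed.

Let sd : R := Num.sqrt 2^-1.

Lemma normal_pdf_half x : normal_pdf 0 sd x = normal_peak sd * expR (- x ^+ 2).
Proof.
rewrite normal_pdfE ?gt_eqF ?sqrtr_gt0 ?invr_gt0// /normal_fun subr0.
by rewrite /sd sqr_sqrtr ?invr_ge0// -[2^-1 *+ 2]mulr_natr mulVf ?pnatr_eq0// divr1.
Qed.

Lemma integrable_expX_gauss k :
  mu.-integrable [set: R] (fun x => (x ^+ k * expR (- x ^+ 2))%:E).
Proof.
(* The inverse peak turns [normal_pdf 0 1] into exp(-x^2 / 2). *)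
pose C : R := (1 + 2 ^+ k * k`!%:R) * (normal_peak 1)^-1.
have B (x : R) : `|x ^+ k * expR (- x ^+ 2)| <= `|C * normal_pdf 0 1 x|.
  rewrite normrM normrX (ger0_norm (expR_ge0 _)).
  apply: le_trans (normr_expX_gauss_le k x) _; apply: le_trans (ler_norm _).
  rewrite normal_pdfE ?oner_eq0// /normal_fun subr0 expr1n /C -mulrA mulKf//.
  by rewrite gt_eqF// normal_peak_gt0 ?oner_eq0.
apply: (@le_integrable _ _ R mu setT measurableT _ (fun x : R => C%:E * (normal_pdf 0 1 x)%:E)%E).
- apply/measurable_EFinP/measurable_funM; first exact: exprn_measurable.
  by apply: measurableT_comp => //; apply: measurableT_comp => //; exact: exprn_measurable.
- by move=> x _; rewrite -EFinM !abse_EFin lee_fin; exact: B.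
- by apply: integrableZl => //; exact: integrable_normal_pdf.
Qed.

(** For [k = 0] the coefficient [k%:R] cancels the term with the truncated exponent [k.-1]. *)
Lemma is_derive_expX_gauss k (x : R) :
  is_derive x (1 : R) (fun x : R => x ^+ k * expR (- x ^+ 2))
    (k%:R * (x ^+ k.-1 * expR (- x ^+ 2)) - 2 * (x ^+ k.+1 * expR (- x ^+ 2))).
Proof.
have H1 : is_derive x (1 : R) (fun x : R => x ^+ k) (k%:R * x ^+ k.-1).
  have := is_deriveX k (is_derive_id x (1 : R)); rewrite exprfctE => /is_derive_eq; apply.
  by rewrite /GRing.scale /= mulr1.
have H2 : is_derive x (1 : R) (fun x : R => expR (- x ^+ 2)) (expR (- x ^+ 2) * (- (2 * x))).
  apply: (@is_derive1_comp _ expR (fun x : R => - x ^+ 2)).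
  by apply: is_derive_eq; rewrite /GRing.scale /= !mulr1 mulr_natl mulr2n.
have /is_derive_eq := is_deriveM H1 H2; apply; rewrite /GRing.scale /= (exprS x k); ring.
Qed.

Lemma continuous_expX_gauss k : continuous (fun x : R => x ^+ k * expR (- x ^+ 2)).
Proof.
move=> x; apply: differentiable_continuous; apply/derivable1_diffP.
by case: (is_derive_expX_gauss k x).
Qed.

(** [e] is 1 or -1, so that both ends of the line are treated at once. *)
Lemma expX_gauss_vanishing k (e : R) : e ^+ 2 = 1 ->
  (e * n%:R) ^+ k * expR (- (e * n%:R) ^+ 2) @[n --> \oo] --> (0 : R).
Proof.
move=> e1; pose C : R := 1 + 2 ^+ k * k`!%:R.
have ne1 : `|e| = 1 by apply/eqP; rewrite -sqrp_eq1 // real_normK ?num_real ?e1.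
apply/norm_cvg0P.
(* The bound comes from exp(n^2 / 2) >= 1 + n^2 / 2 >= (n + 1) / 2. *)
apply: (@squeeze_cvgr _ _ _ _ (fun=> 0) (fun n => C * 2 * harmonic n)).
- near=> n; rewrite normr_ge0 /= normrM normrX (ger0_norm (expR_ge0 _)).
  apply: le_trans (normr_expX_gauss_le k _) _; rewrite -/C -mulrA ler_wpM2l//.
    by rewrite addr_ge0// mulr_ge0// exprn_ge0.
  rewrite exprMn e1 mul1r mulNr expRN /harmonic ler_pdivlMr// mulrC ler_pdivrMr ?expR_gt0//.
  have := expR_ge1Dx (n%:R ^+ 2 / 2 : R); have := sqr_ge0 (n%:R - 1 : R).
  rewrite -[n.+1%:R]natr1; set z := expR _; set y := n%:R : R; nra.
- exact: cvg_cst.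
- rewrite -[X in _ --> X](mulr0 (C * 2)); apply: cvgMr; exact: cvg_harmonic.
Unshelve. all: by end_near. Qed.

(** The derivative of x^k exp(-x^2) has integral zero over the line. *)
Lemma integral_expX_gauss_rec k :
  (k%:R%:E * \int[mu]_x (x ^+ k.-1 * expR (- x ^+ 2))%:E =
   2%:E * \int[mu]_x (x ^+ k.+1 * expR (- x ^+ 2))%:E)%E.
Proof.
pose f (x : R) := k%:R * (x ^+ k.-1 * expR (- x ^+ 2)) - 2 * (x ^+ k.+1 * expR (- x ^+ 2)).
have I1 := integrable_expX_gauss k.-1; have I2 := integrable_expX_gauss k.+1.
have fE : EFin \o f = (fun x => k%:R%:E * (x ^+ k.-1 * expR (- x ^+ 2))%:E
    - 2%:E * (x ^+ k.+1 * expR (- x ^+ 2))%:E)%E.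
  by apply/funext => x; rewrite /= /f EFinB !EFinM.
have If : mu.-integrable [set: R] (EFin \o f).
  by rewrite fE; apply: integrableB => //; exact: integrableZl.
have := integral_derivative_vanishing (is_derive_expX_gauss k) _ If.
rewrite -[X in continuous X]/f -/f.
have cf : continuous f.
  move=> x; apply: (@cvgB _ R^o).
    by apply: cvgMr; exact: continuous_expX_gauss.
  by apply: cvgMr; exact: continuous_expX_gauss.
have Fy : n%:R ^+ k * expR (- n%:R ^+ 2) @[n --> \oo] --> (0 : R).
  by have := @expX_gauss_vanishing k 1 (expr1n _ _); under eq_fun do rewrite mul1r.
have FNy : (- n%:R) ^+ k * expR (- (- n%:R) ^+ 2) @[n --> \oo] --> (0 : R).
  by have := @expX_gauss_vanishing k (-1) (sqrr_sign _ 1); under eq_fun do rewrite mulN1r.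
move=> /(_ cf Fy FNy).
rewrite [X in X = _](_ : _ = \int[mu]_x (EFin \o f) x)%E// fE integralB//; last 2 first.
  exact: integrableZl.
  exact: integrableZl.
rewrite !integralZl//.
rewrite -(fineK (integrable_fin_num measurableT I1)) -(fineK (integrable_fin_num measurableT I2)).
by rewrite -!EFinM -EFinB => H; congr EFin; apply: subr0_eq; case: H.
Qed.

(** Moments of N(0, 1/2): 0 for odd [k] and (k - 1)!! / 2^(k / 2) for even [k], encoded by the
    recursion that integration by parts provides. *)
Fixpoint gauss_moment k : R :=
  if k is k'.+1 then
    if k' is j.+1 then k'%:R / 2 * gauss_moment j else 0
  else 1.

Lemma gauss_moment_rec k : gauss_moment k.+1 = k%:R / 2 * gauss_moment k.-1.
Proof. by case: k => // ; rewrite !mul0r. Qed.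

Lemma integral_expX_normal k :
  mu.-integrable [set: R] (fun x => (x ^+ k * normal_pdf 0 sd x)%:E) /\
  (\int[mu]_x (x ^+ k * normal_pdf 0 sd x)%:E = (gauss_moment k)%:E)%E.
Proof.
have E j : (fun x : R => (x ^+ j * normal_pdf 0 sd x)%:E) =
    (fun x => (normal_peak sd)%:E * (x ^+ j * expR (- x ^+ 2))%:E)%E.
  by apply/funext => x; rewrite normal_pdf_half mulrCA EFinM.
have I j := integrable_expX_gauss j.
split; first by rewrite E; exact: integrableZl.
(* Strong induction, since the recursion descends by two. *)
have [j] := ubnP k; elim: j k => // j IH [|k] kj.
  under eq_integral do rewrite expr0 mul1r.
  exact: integral_normal_pdf.
have [r Er] : exists r, (\int[mu]_x (x ^+ k.+1 * normal_pdf 0 sd x)%:E = r%:E)%E.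
  rewrite E integralZl//; eexists.
  by rewrite -(fineK (integrable_fin_num measurableT (I k.+1))) -EFinM.
have [r' Er'] : exists r, (\int[mu]_x (x ^+ k.-1 * normal_pdf 0 sd x)%:E = r%:E)%E.
  rewrite E integralZl//; eexists.
  by rewrite -(fineK (integrable_fin_num measurableT (I k.-1))) -EFinM.
have rec : k%:R * r' = 2 * r.
  apply: EFin_inj; rewrite !EFinM -Er -Er' !E !integralZl//.
  by rewrite muleCA [RHS]muleCA integral_expX_gauss_rec.
rewrite Er gauss_moment_rec; congr EFin.
case: k kj Er Er' rec => [|k] kj Er Er' rec; first by move: rec; rewrite !mul0r; lra.
have : r' = gauss_moment k by apply: EFin_inj; rewrite -Er' IH//; lia.
by move=> <-; lra.
Qed.

(** Transfer between [X] under [P] with weight 1 and the identity under Lebesgue measure with the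
    normal density as weight. *)
Lemma half_gaussian_moment (d : measure_display) (T : measurableType d)
    (P : probability T R) (X : T -> R) k : half_gaussian P X ->
  P.-integrable [set: T] (fun t => (X t ^+ k)%:E) /\
  (\int[P]_t (X t ^+ k)%:E = (gauss_moment k)%:E)%E.
Proof.
move=> [mX PX]; have [I E] := integral_expX_normal k.
have H B : measurable B -> (\int[P]_(t in X @^-1` B) (cst 1 t)%:E =
    \int[mu]_(x in id @^-1` B) (normal_pdf 0 sd x)%:E)%E.
  move=> mB; rewrite -[LHS]/(\int[P]_(t in X @^-1` B) (cst 1 t))%E integral_cst; last first.
    by rewrite -[X in measurable X]setTI; exact: mX.
  by rewrite mul1e; exact: PX.
have mpdf : measurable_fun [set: R] (normal_pdf 0 sd) := measurable_normal_pdf _ _.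
have h0 (t : T) : (0 : R) <= cst 1 t by [].
have p0 x : 0 <= normal_pdf 0 sd x := normal_pdf_ge0 _ _ _.
have eqX : (fun t => (X t ^+ k)%:E) = (fun t => (X t ^+ k * cst 1 t)%:E).
  by apply/funext => t; rewrite mulr1.
rewrite eqX; split.
  exact: (@integrable_transfer _ _ _ T _ R R P mu X id (cst 1) _ mX
    (@measurable_id _ _ _) (@measurable_cst _ _ _ _ _ _) mpdf h0 p0 H
    (fun x => x ^+ k) (exprn_measurable _) I).
rewrite (@integral_transfer _ _ _ T _ R R P mu X id (cst 1) _ mX
  (@measurable_id _ _ _) (@measurable_cst _ _ _ _ _ _) mpdf h0 p0 H
  (fun x => x ^+ k) (exprn_measurable _)).
exact: E.
Qed.
End GaussianMoments.

(** * The Wick formula *)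

Section ComplexExpectation.
Local Open Scope classical_set_scope.
Local Open Scope ring_scope.
Local Open Scope complex_scope.
Variables (d : measure_display) (T : measurableType d) (R : realType)
  (P : probability T R).

(** [cexpectation] applies [fine] to two real integrals; this is the class on which its linearity is
    established. *)
Definition complex_integrable (Z : T -> R[i]) : Prop :=
  P.-integrable [set: T] (fun t => (complex.Re (Z t))%:E) /\
  P.-integrable [set: T] (fun t => (complex.Im (Z t))%:E).

Lemma fine_expectation_lin (a b : R) (X Y : T -> R) :
  P.-integrable [set: T] (fun t => (X t)%:E) ->
  P.-integrable [set: T] (fun t => (Y t)%:E) ->
  P.-integrable [set: T] (fun t => (a * X t + b * Y t)%:E) /\
  fine 'E_P[fun t => a * X t + b * Y t] = a * fine 'E_P[X] + b * fine 'E_P[Y].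
Proof.
move=> iX iY.
have iaX : P.-integrable [set: T] (fun t => (a * X t)%:E).
  by under eq_fun do rewrite EFinM; exact: integrableZl.
have ibY : P.-integrable [set: T] (fun t => (b * Y t)%:E).
  by under eq_fun do rewrite EFinM; exact: integrableZl.
split; first by under eq_fun do rewrite EFinD; exact: integrableD.
by rewrite unlock -!/(Rintegral _ _ _) RintegralD// !RintegralZl.
Qed.

Lemma cexpectation_lin (c : R[i]) (Z W : T -> R[i]) :
  complex_integrable Z -> complex_integrable W ->
  complex_integrable (fun t => c * Z t + W t) /\
  cexpectation P (fun t => c * Z t + W t) =
  c * cexpectation P Z + cexpectation P W.
Proof.
case: c => a b [iRZ iIZ] [iRW iIW].
have reE : (fun t => complex.Re ((a +i* b) * Z t + W t)) =
    (fun t => 1 * (a * complex.Re (Z t) + - b * complex.Im (Z t)) + 1 * complex.Re (W t)).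
  by apply/funext => t; case: (Z t) => x y; case: (W t) => u v /=; ring.
have imE : (fun t => complex.Im ((a +i* b) * Z t + W t)) =
    (fun t => 1 * (a * complex.Im (Z t) + b * complex.Re (Z t)) + 1 * complex.Im (W t)).
  by apply/funext => t; case: (Z t) => x y; case: (W t) => u v /=; ring.
have [i1 E1] := fine_expectation_lin a (- b) iRZ iIZ.
have [i2 E2] := fine_expectation_lin a b iIZ iRZ.
have [i3 E3] := fine_expectation_lin 1 1 i1 iRW.
have [i4 E4] := fine_expectation_lin 1 1 i2 iIW.
split.
  split.
    by rewrite (_ : (fun t => _) =
      EFin \o (fun t => complex.Re ((a +i* b) * Z t + W t)))// reE.
  by rewrite (_ : (fun t => _) =
    EFin \o (fun t => complex.Im ((a +i* b) * Z t + W t)))// imE.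
rewrite /cexpectation reE imE E3 E4 E1 E2.
by apply/eqP; rewrite eq_complex /=; apply/andP; split; apply/eqP; ring.
Qed.

Lemma complex_integrable0 : complex_integrable (fun=> 0).
Proof. by split; exact: integrable0. Qed.

Lemma cexpectation0 : cexpectation P (fun=> 0) = 0.
Proof. by rewrite /cexpectation /= (expectation_cst P 0). Qed.

Let cexpectation_lincomb (J : Type) (s : seq J) (Q : pred J) (c : J -> R[i])
    (Z : J -> T -> R[i]) : (forall j, Q j -> complex_integrable (Z j)) ->
  complex_integrable (fun t => \sum_(j <- s | Q j) c j * Z j t) /\
  cexpectation P (fun t => \sum_(j <- s | Q j) c j * Z j t) =
  \sum_(j <- s | Q j) c j * cexpectation P (Z j).
Proof.
move=> iZ; elim: s => [|j s [IH1 IH2]].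
  rewrite big_nil (_ : (fun t => _) = fun=> 0).
    by split; [exact: complex_integrable0|exact: cexpectation0].
  by apply/funext => t; rewrite big_nil.
have E : (fun t => \sum_(k <- j :: s | Q k) c k * Z k t) =
    if Q j then (fun t => c j * Z j t + \sum_(k <- s | Q k) c k * Z k t)
    else (fun t => \sum_(k <- s | Q k) c k * Z k t).
  by case: ifP => Qj; apply/funext => t; rewrite big_cons Qj.
rewrite E big_cons; case: ifP => Qj //.
by rewrite -IH2; exact: cexpectation_lin (iZ _ Qj) IH1.
Qed.

Lemma complex_integrable_sum (J : Type) (s : seq J) (Q : pred J) (c : J -> R[i])
    (Z : J -> T -> R[i]) : (forall j, Q j -> complex_integrable (Z j)) ->
  complex_integrable (fun t => \sum_(j <- s | Q j) c j * Z j t).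
Proof. by move=> iZ; case: (cexpectation_lincomb s c iZ). Qed.

Lemma cexpectation_sum (J : Type) (s : seq J) (Q : pred J) (c : J -> R[i])
    (Z : J -> T -> R[i]) : (forall j, Q j -> complex_integrable (Z j)) ->
  cexpectation P (fun t => \sum_(j <- s | Q j) c j * Z j t) =
  \sum_(j <- s | Q j) c j * cexpectation P (Z j).
Proof. by move=> iZ; case: (cexpectation_lincomb s c iZ). Qed.

Lemma cexpectationZ (c : R[i]) (Z : T -> R[i]) : complex_integrable Z ->
  cexpectation P (fun t => c * Z t) = c * cexpectation P Z.
Proof.
move=> iZ; have := cexpectation_lin c iZ complex_integrable0.
by under eq_fun do rewrite addr0; rewrite cexpectation0 addr0 => -[].
Qed.

Lemma cexpectation_real (f : T -> R) (r : R) :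
  P.-integrable [set: T] (fun t => (f t)%:E) ->
  (\int[P]_t (f t)%:E = r%:E)%E ->
  complex_integrable (fun t => (f t)%:C) /\ cexpectation P (fun t => (f t)%:C) = r%:C.
Proof.
move=> iF Er; split; first by split => //=; exact: integrable0.
by rewrite /cexpectation /= (expectation_cst P 0) unlock Er.
Qed.
End ComplexExpectation.

(** * Real coordinates of a Ginibre matrix *)

Section Ginibre.
Local Open Scope classical_set_scope.
Local Open Scope ring_scope.
Local Open Scope complex_scope.
Variables (d : measure_display) (T : measurableType d) (R : realType)
  (P : probability T R) (M N : nat) (G : T -> 'M[R[i]]_(M, N)).
Hypothesis ginG : complex_ginibre P G.

Definition coord (i : ('I_M * 'I_N) * bool) (t : T) : R :=
  if i.2 then complex.Im (G t i.1.1 i.1.2) else complex.Re (G t i.1.1 i.1.2).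

Lemma half_gaussian_coord i : half_gaussian P (coord i).
Proof.
by case: i => -[i j] b; have [Gij _] := ginG; case: (Gij i j) => h0 h1 _; case: b.
Qed.

(** Independence of the entries is tested on rectangles; then the real and imaginary parts inside
    each entry are separated. *)
Lemma independent_coord : mutually_independent P coord.
Proof.
move=> B mB; have [Gij indG] := ginG.
have := indG (fun ij => B (ij, false) `*` B (ij, true)) _.
move=> /(_ _)/wrap[ij|]; first exact: measurableX.
have -> : \bigcap_(i in [set: 'I_M * 'I_N]) ((fun t =>
     (complex.Re (G t i.1 i.2), complex.Im (G t i.1 i.2))) @^-1`
     (B (i, false) `*` B (i, true))) = \bigcap_(i in [set: _]) (coord i @^-1` B i).
  apply/seteqP; split => t /= H.
    by move=> [ij b] _; have [/= h1 h2] := H ij Logic.I; case: b.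
  by move=> ij _; split; [apply: (H (ij, false))|apply: (H (ij, true))].
move=> ->; transitivity (\prod_ij \prod_(b : bool) P (coord (ij, b) @^-1` B (ij, b)))%E; last first.
  by rewrite pair_bigA; apply: eq_bigr => -[].
apply: eq_bigr => -[i j] _; have [_ _ indb] := Gij i j.
rewrite -(indb (fun b => B ((i, j), b)))//; congr (P _).
apply/seteqP; split => t /=; first by move=> [/= h1 h2] [] _.
by move=> H; split; [apply: (H false)|apply: (H true)].
Qed.
End Ginibre.

(** * Gaussian integration by parts *)

Section GaussianFamily.
Local Open Scope classical_set_scope.
Local Open Scope ring_scope.
Local Open Scope complex_scope.
Variables (d : measure_display) (T : measurableType d) (R : realType)
  (P : probability T R) (I : finType) (g : I -> T -> R).
Hypotheses (gaussg : forall i, half_gaussian P (g i))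
  (indg : mutually_independent P g).

(** Independence concerns distinct variables, so repeated factors are collected into exponents. *)
Lemma prod_multiplicity (K : comPzSemiRingType) (J : finType) (Q : pred J)
    (F : J -> I) (x : I -> K) :
  \prod_(j | Q j) x (F j) = \prod_i x i ^+ (\sum_(j | Q j) (F j == i))%N.
Proof.
under [RHS]eq_bigr do rewrite -prodrXr.
rewrite exchange_big; apply: eq_bigr => j _.
rewrite (bigD1 (F j))//= eqxx big1 ?mulr1// => i.
by rewrite eq_sym => /negPf ->.
Qed.

Lemma integral_monomial (c : I -> nat) :
  P.-integrable [set: T] (fun t => (\prod_i g i t ^+ c i)%:E) /\
  (\int[P]_t (\prod_i g i t ^+ c i)%:E = (\prod_i gauss_moment R (c i))%:E)%E.
Proof.
apply: (integral_prod_indep (F := fun i x => x ^+ c i) _ indg) => i.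
- by case: (gaussg i).
- exact: exprn_measurable.
- by case: (half_gaussian_moment (c i) (gaussg i)).
- by case: (half_gaussian_moment (c i) (gaussg i)).
Qed.

(** Integration by parts for a monomial: one more factor [g e] raises the exponent of [e] from [c e]
    to [c e + 1]. The moment recursion yields the coefficient [c e / 2], spread over the [c e]
    indices [j] with [F j = e]. *)
Lemma gauss_moment_stein (J : finType) (F : J -> I) (e : I) :
  \prod_i gauss_moment R ((i == e) + \sum_j (F j == i)) =
  \sum_j (F j == e)%:R / 2 *
    \prod_i gauss_moment R (\sum_(k | k != j) (F k == i)).
Proof.
pose c i := (\sum_j (F j == i))%N.
have cD j i : (c i = (F j == i) + \sum_(k | k != j) (F k == i))%N.
  by rewrite /c (bigD1 j).
transitivity (\sum_j (F j == e)%:R / 2 *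
    (gauss_moment R (c e).-1 * \prod_(i | i != e) gauss_moment R (c i))).
  rewrite -mulr_suml -mulr_suml -natr_sum -/(c e) (bigD1 e)//= eqxx add1n.
  rewrite gauss_moment_rec -/(c e) mulrA; congr (_ * _).
  by apply: eq_bigr => i /negPf ->.
apply: eq_bigr => j _; have [Fj|] := eqVneq (F j) e; last by rewrite !mul0r.
congr (_ * _); rewrite [RHS](bigD1 e)//=; congr (_ * _).
  by rewrite (cD j) Fj eqxx.
apply: eq_bigr => i ie; rewrite (cD j) Fj eq_sym (negPf ie)//.
Qed.

(** Entries of a Ginibre matrix and their conjugates both have this form, complex coefficients on
    real variables, so one recursion covers both. *)
Definition linform (a : I -> R[i]) (t : T) : R[i] := \sum_i a i * (g i t)%:C.

Let monomial (J : finType) (Q : pred J) (F : J -> I) t := \prod_(j | Q j) g (F j) t.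
Let moment (J : finType) (Q : pred J) (F : J -> I) : R :=
  \prod_i gauss_moment R (\sum_(j | Q j) (F j == i)).

Lemma cexpectation_monomial (J : finType) (Q : pred J) (F : J -> I) :
  complex_integrable P (fun t => (monomial Q F t)%:C) /\
  cexpectation P (fun t => (monomial Q F t)%:C) = (moment Q F)%:C.
Proof.
have [i1 E1] := integral_monomial (fun i => \sum_(j | Q j) (F j == i))%N.
rewrite (_ : (fun t => _) = fun t => (\prod_i g i t ^+ (\sum_(j | Q j) (F j == i))%N)%:C).
  exact: cexpectation_real i1 E1.
by apply/funext => t; rewrite /monomial (prod_multiplicity _ _ (fun i => g i t)).
Qed.

Lemma complex_integrable_prod_linform (J : finType) (Q : pred J) (a : J -> I -> R[i]) :
  complex_integrable P (fun t => \prod_(j | Q j) linform (a j) t).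
Proof.
(* Distributing the product over the sums asks for factors indexed by a whole finite type, hence the
   passage to positions in the filtered list. *)
under eq_fun do rewrite -big_filter big_tnth bigA_distr_bigA.
under eq_fun do under eq_bigr do rewrite big_split /= -rmorph_prod.
set r := [seq j <- index_enum J | Q j].
apply: (@complex_integrable_sum _ _ _ P _ (index_enum {ffun 'I_(size r) -> I}) predT
  (fun F => \prod_j a (tnth (in_tuple r) j) (F j)) (fun F t => (monomial predT F t)%:C)).
by move=> F _; exact: (cexpectation_monomial predT F).1.
Qed.

Lemma cexpectation_coord_mul (J : finType) (e : I) (a : J -> I -> R[i]) :
  complex_integrable P (fun t => (g e t)%:C * \prod_j linform (a j) t) /\
  cexpectation P (fun t => (g e t)%:C * \prod_j linform (a j) t) =
  \sum_j a j e / 2 * cexpectation P (fun t => \prod_(k | k != j) linform (a k) t).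
Proof.
pose Z (F : {ffun J -> I}) t := (\prod_i g i t ^+ ((i == e) + \sum_j (F j == i)))%:C.
have gZ t : (g e t)%:C * \prod_j linform (a j) t =
    \sum_(F : {ffun J -> I}) (\prod_j a j (F j)) * Z F t.
  rewrite /linform bigA_distr_bigA big_distrr; apply: eq_bigr => F _ /=.
  rewrite big_split mulrCA; congr (_ * _); rewrite -rmorph_prod -rmorphM; congr _%:C.
  rewrite (prod_multiplicity _ _ (fun i => g i t)).
  under [RHS]eq_bigr do rewrite exprD.
  rewrite big_split /=; congr (_ * _).
  rewrite (bigD1 e)//= eqxx expr1 big1 ?mulr1// => i /negPf -> //.
have ZE F : complex_integrable P (Z F) /\ cexpectation P (Z F) =
    (\sum_j (F j == e)%:R / 2 * moment (fun k => k != j) F)%:C.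
  have [i1 E1] := integral_monomial (fun i => (i == e) + \sum_j (F j == i))%N.
  have := cexpectation_real i1 E1.
  by rewrite gauss_moment_stein.
rewrite (_ : (fun t => _) = fun t => \sum_(F : {ffun J -> I}) (\prod_j a j (F j)) * Z F t).
  have iZ F := (ZE F).1.
  split; first by apply: complex_integrable_sum.
  rewrite cexpectation_sum//; under eq_bigr do rewrite (ZE _).2 rmorph_sum mulr_sumr.
  rewrite exchange_big; apply: eq_bigr => j _ /=.
  rewrite mulrAC -cexpectationZ; last exact: complex_integrable_prod_linform.
  have E t : a j e * \prod_(k | k != j) linform (a k) t =
     \sum_(F : {ffun J -> I}) ((F j == e)%:R * \prod_k a k (F k)) *
        (monomial (fun k => k != j) F t)%:C.
    (* Factor [j] is replaced by its coefficient at [e], written as a sum with a delta so that all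
       factors expand together. *)
    pose h k i := if k == j then (i == e)%:R * a k i else a k i * (g i t)%:C.
    transitivity (\prod_k \sum_i h k i).
      rewrite [RHS](bigD1 j)//= /h eqxx; congr (_ * _).
        rewrite (bigD1 e)//= eqxx mul1r big1 ?addr0// => i /negPf ->; exact: mul0r.
      by apply: eq_bigr => k /negPf ->.
    rewrite bigA_distr_bigA; apply: eq_bigr => F _.
    rewrite (bigD1 j)//= {1}/h eqxx -!mulrA; congr (_ * _).
    rewrite [in RHS](bigD1 j)//= -mulrA; congr (_ * _).
    rewrite /monomial rmorph_prod -big_split; apply: eq_bigr => k /negPf kj.
    by rewrite /h kj.
  rewrite (funext E) cexpectation_sum; last first.
    by move=> F _; exact: (cexpectation_monomial _ F).1.
  rewrite mulr_suml; apply: eq_bigr => F _.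
  rewrite (cexpectation_monomial _ F).2 !rmorphM fmorphV !rmorph_nat; ring.
by apply/funext => t; exact: gZ.
Qed.

(** Wick recursion: the first form is paired with each of the others. The coefficient is their
    bilinear covariance, each coordinate having variance 1/2. *)
Lemma cexpectation_linform_mul (J : finType) (b : I -> R[i]) (a : J -> I -> R[i]) :
  cexpectation P (fun t => linform b t * \prod_j linform (a j) t) =
  \sum_j (\sum_i b i * a j i / 2) *
     cexpectation P (fun t => \prod_(k | k != j) linform (a k) t).
Proof.
have E t : linform b t * \prod_j linform (a j) t =
    \sum_i b i * ((g i t)%:C * \prod_j linform (a j) t).
  by rewrite mulr_suml; apply: eq_bigr => i _; rewrite mulrA.
rewrite (funext E) cexpectation_sum; last by move=> i _; case: (cexpectation_coord_mul i a).
under eq_bigr do rewrite (cexpectation_coord_mul _ a).2 mulr_sumr.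
rewrite exchange_big; apply: eq_bigr => j _ /=; rewrite mulr_suml.
by apply: eq_bigr => i _; rewrite !mulrA.
Qed.
End GaussianFamily.

(** In the Wick recursion [k] is the partner of the first factor and [s] matches the remaining
    ones. *)
Lemma sum_lift_perm (V : nmodType) (n : nat) (F : 'S_n.+1 -> V) :
  \sum_s F s = \sum_k \sum_(s : 'S_n) F (lift_perm ord0 k s).
Proof.
rewrite (partition_big (fun s : 'S_n.+1 => s ord0) predT) //=.
apply: eq_bigr => k _; rewrite (reindex (lift_perm ord0 k)); last first.
  pose f (s : 'S_n.+1) j := odflt j (unlift (s ord0) (s (lift ord0 j))).
  have fK (s : 'S_n.+1) j : lift (s ord0) (f s j) = s (lift ord0 j).
    rewrite /f; have := neq_lift ord0 j.
    by rewrite -(can_eq (permK s)) => /unlift_some[] ? ? ->.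
  have inj_f s : injective (f s).
    by move=> i j /(congr1 (lift (s ord0))); rewrite !fK => /perm_inj/lift_inj.
  exists (fun s => perm (@inj_f s)) => [s _ | s].
    by apply/permP => j; rewrite permE /f lift_perm_lift lift_perm_id liftK.
  move/eqP => s0; apply/permP => j.
  case: (unliftP ord0 j) => [j'|] ->; rewrite ?lift_perm_id //.
  by rewrite lift_perm_lift -s0 permE fK.
by apply: eq_bigl => s; rewrite lift_perm_id eqxx.
Qed.

(** * Wick formula for the entries of a Ginibre matrix *)

Section Wick.
Local Open Scope classical_set_scope.
Local Open Scope ring_scope.
Local Open Scope complex_scope.
Variables (d : measure_display) (T : measurableType d) (R : realType)
  (P : probability T R) (M N : nat) (G : T -> 'M[R[i]]_(M, N)).
Hypothesis ginG : complex_ginibre P G.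
Implicit Types x y : 'I_M * 'I_N.

Let coefG x (i : ('I_M * 'I_N) * bool) : R[i] :=
  (i.1 == x)%:R * (if i.2 then 'i else 1).
Let coefC x (i : ('I_M * 'I_N) * bool) : R[i] :=
  (i.1 == x)%:R * (if i.2 then - 'i else 1).

Let sum_coef x (h : bool -> R[i]) (f : ('I_M * 'I_N) * bool -> R[i]) :
  \sum_i (i.1 == x)%:R * h i.2 * f i = h false * f (x, false) + h true * f (x, true).
Proof.
transitivity (\sum_a \sum_(b : bool) (a == x)%:R * h b * f (a, b)).
  by rewrite pair_bigA; apply: eq_bigr => -[].
have H a : a != x -> \sum_(b : bool) (a == x)%:R * h b * f (a, b) = 0.
  by move=> /negPf ax; rewrite big_bool ax /= !mul0r addr0.
by rewrite (bigD1 x)//= [X in _ + X](big1 _ _ _ H) addr0 big_bool /= eqxx !mul1r addrC.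
Qed.

Let linG x t : G t x.1 x.2 = linform (coord G) (coefG x) t.
Proof.
rewrite /linform /coefG (sum_coef x (fun b => if b then 'i else 1)) /coord /= mul1r.
exact: complexE.
Qed.

Let linC x t : ((G t x.1 x.2)^*)%R = linform (coord G) (coefC x) t.
Proof.
rewrite /linform /coefC (sum_coef x (fun b => if b then - 'i else 1)) /coord /= mul1r.
case: (G t x.1 x.2) => u v; apply/eqP; rewrite eq_complex /=.
by apply/andP; split; apply/eqP; simpl; ring.
Qed.

(** 1 + i^2 = 0, so two unconjugated entries never pair. With one of them conjugated, 1 - i^2 = 2
    and the variance 1/2 gives covariance 1. *)
Let covGG x y : \sum_i coefG x i * coefG y i / 2 = 0.
Proof.
rewrite -mulr_suml (sum_coef x (fun b => if b then 'i else 1)) /coefG /=.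
by rewrite mul1r mulr1 mulrCA -expr2 sqr_i mulrN1 subrr mul0r.
Qed.

Let covGC x y : \sum_i coefG x i * coefC y i / 2 = (x == y)%:R.
Proof.
rewrite -mulr_suml (sum_coef x (fun b => if b then 'i else 1)) /coefC /=.
rewrite mul1r mulr1 mulrCA mulrN -expr2 sqr_i opprK mulr1.
by set e := (x == y)%:R; rewrite -mulr2n -[e *+ 2]mulr_natr mulfK// pnatr_eq0.
Qed.

Lemma complex_integrable_wick p (x y : 'I_p -> 'I_M * 'I_N) :
  complex_integrable P
    (fun t => \prod_r (G t (x r).1 (x r).2 * (G t (y r).1 (y r).2)^*)).
Proof.
pose a (j : 'I_p + 'I_p) := match j with inl r => coefG (x r) | inr r => coefC (y r) end.
rewrite (_ : (fun t => _) = fun t => \prod_j linform (coord G) (a j) t).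
  apply: complex_integrable_prod_linform; first exact: half_gaussian_coord.
  exact: independent_coord.
apply/funext => t; rewrite big_sumType /= -big_split; apply: eq_bigr => r _.
by rewrite (linG (x r)) (linC (y r)).
Qed.

(** The first unconjugated factor can only pair with a conjugated one, of index [k]; [lift ord0] and
    [lift k] then renumber the factors that remain. *)
Lemma wick p (x y : 'I_p -> 'I_M * 'I_N) :
  cexpectation P (fun t => \prod_r (G t (x r).1 (x r).2 * (G t (y r).1 (y r).2)^*)) =
  \sum_(s : 'S_p) [forall r, x r == y (s r)]%:R.
Proof.
elim: p x y => [|p IH] x y.
  rewrite (_ : (fun t => _) = fun=> 1); last by apply/funext => t; rewrite big_ord0.
  rewrite /cexpectation /= (expectation_cst P 1) (expectation_cst P 0).
  rewrite (bigD1 1%g)//= big1 ?addr0 => [|s]; last first.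
    by move/eqP => []; apply/permP => -[].
  by rewrite (_ : [forall r, _] = true)//; apply/forallP => -[].
(* The left summand has lost the first unconjugated factor, the one being expanded; the right
   summand still has all conjugated ones. *)
pose a (j : 'I_p + 'I_p.+1) := match j with
  inl r => coefG (x (lift ord0 r)) | inr r => coefC (y r) end.
rewrite (_ : (fun t => _) = fun t =>
    linform (coord G) (coefG (x ord0)) t * \prod_j linform (coord G) (a j) t); last first.
  apply/funext => t; rewrite big_split big_sumType /= big_ord_recl -mulrA linG.
  congr (_ * (_ * _)); apply: eq_bigr => r _; [by rewrite linG|by rewrite linC].
rewrite (cexpectation_linform_mul (half_gaussian_coord ginG) (independent_coord ginG)).
rewrite big_sumType /= big1 ?add0r => [|r _]; last by rewrite covGG mul0r.
rewrite sum_lift_perm; apply: eq_bigr => k _; rewrite covGC.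
rewrite (_ : (fun t => _) = fun t => \prod_r
   (G t (x (lift ord0 r)).1 (x (lift ord0 r)).2 *
    (G t (y (lift k r)).1 (y (lift k r)).2)^*)); last first.
  apply/funext => t; rewrite big_sumType /= [RHS]big_split /=; congr (_ * _).
    by apply: eq_bigr => r _; rewrite linG.
  rewrite [LHS](_ : _ = \prod_(j | j != k) (G t (y j).1 (y j).2)^*); last first.
    apply: eq_big => [j|j _]; [by []|by rewrite linC].
  rewrite [LHS](reindex_omap (lift k) (unlift k)) /=; last first.
    by move=> j; rewrite eq_sym => /unlift_some[j' -> ->].
  by apply: eq_bigl => j; rewrite liftK eqxx eq_sym neq_lift.
rewrite IH mulr_sumr; apply: eq_bigr => s _ /=.
rewrite -natrM mulnb; congr (_ %:R); congr nat_of_bool.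
apply/idP/forallP => [/andP[x0 /forallP H] r|H].
  by case: (unliftP ord0 r) => [r'|] ->; rewrite ?lift_perm_lift ?lift_perm_id.
rewrite -[X in y X](lift_perm_id ord0 k s) H /=; apply/forallP => r.
by rewrite -(lift_perm_lift ord0 k s r) H.
Qed.
End Wick.

(** * Traces of powers of the modified Wishart matrix *)

(** An invariant function is the pullback by [Phi] of an arbitrary function on the orbits. *)
Lemma card_invariant_ffun (T D : finType) (s : {perm T}) :
  #|[pred f : {ffun T -> D} | [forall x, f x == f (s x)]]| = (#|D| ^ #|porbits s|)%N.
Proof.
pose J := {O : {set T} | O \in porbits s}.
have memO x : porbit s x \in porbits s by exact: imset_f.
pose Phi (h : {ffun J -> D}) := [ffun x => h (Sub (porbit s x) (memO x))].
have JP (O : J) : exists x, O == Sub (porbit s x) (memO x).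
  case: O => O HO; have /imsetP[x _ Ox] := HO; by exists x; apply/eqP/val_inj.
have injPhi : injective Phi.
  move=> h1 h2 /ffunP E; apply/ffunP => O; have [x /eqP ->] := JP O.
  by have := E x; rewrite !ffunE.
have <- : #|{ffun J -> D}| = (#|D| ^ #|porbits s|)%N by rewrite card_ffun card_sig.
rewrite -(card_imset predT injPhi); apply: eq_card => f; rewrite inE.
apply/idP/idP => [/forallP fs|/imsetP[h _ ->]]; last first.
  apply/forallP => x; rewrite !ffunE; apply/eqP; congr (h _); apply: val_inj => /=.
  by apply/eqP; rewrite eq_porbit_mem porbit_sym (mem_porbit s 1).
have fi i x : f ((s ^+ i)%g x) = f x.
  elim: i => [|i IH]; first by rewrite expg0 perm1.
  by rewrite expgSr permM -(eqP (fs _)).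
apply/imsetP; exists [ffun O => f (xchoose (JP O))] => //; apply/ffunP => x; rewrite !ffunE.
have /eqP/(congr1 val)/= E := xchooseP (JP (Sub (porbit s x) (memO x))).
have : x \in porbit s (xchoose (JP (Sub (porbit s x) (memO x)))) by rewrite -E porbit_id.
by case/porbitP => i {1}->; rewrite fi.
Qed.

Definition ffun_cons (D : Type) p (k : D) (u : {ffun 'I_p -> D}) : {ffun 'I_p.+1 -> D} :=
  [ffun r => oapp u k (unlift ord0 r)].

Lemma ffun_cons0 (D : Type) p (k : D) (u : {ffun 'I_p -> D}) : ffun_cons k u ord0 = k.
Proof. by rewrite ffunE unlift_none. Qed.

Lemma ffun_consS (D : Type) p (k : D) (u : {ffun 'I_p -> D}) r :
  ffun_cons k u (lift ord0 r) = u r.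
Proof. by rewrite ffunE liftK. Qed.

Lemma sum_ffun_cons (V : nmodType) (D : finType) p (F : {ffun 'I_p.+1 -> D} -> V) :
  \sum_u F u = \sum_k \sum_(u : {ffun 'I_p -> D}) F (ffun_cons k u).
Proof.
rewrite pair_bigA (reindex (fun ku : D * {ffun 'I_p -> D} => ffun_cons ku.1 ku.2)) //=.
exists (fun u : {ffun 'I_p.+1 -> D} => (u ord0, [ffun r => u (lift ord0 r)])) => [[k u] _|u _] /=.
  by rewrite ffun_cons0; congr (_, _); apply/ffunP => r; rewrite ffunE ffun_consS.
apply/ffunP => r; case: (unliftP ord0 r) => [j|] ->; last by rewrite ffun_cons0.
by rewrite ffun_consS ffunE.
Qed.

(** * Traces of powers as sums over closed paths *)

Section TracePower.
Variables (K : comPzRingType) (N : nat).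
Implicit Types (X : 'M[K]_N).

(** The end weight [Y] is arbitrary for the sake of the induction; [mxtrace_exp] takes for it the
    column of [X] that closes the path. *)
Lemma sum_path_mx_exp X p i (Y : 'I_N -> K) :
  \sum_(u : {ffun 'I_p -> 'I_N})
     (\prod_(r < p) X (ffun_cons i u (widen_ord (leqnSn p) r)) (u r)) * Y (ffun_cons i u ord_max)
  = \sum_j (X ^+ p) i j * Y j.
Proof.
elim: p i => [|p IH] i.
  rewrite (bigD1 [ffun=> i])//= [X in _ + X]big1 => [|u]; last first.
    by case/eqP; apply/ffunP => -[].
  rewrite big_ord0 mul1r addr0 (_ : ord_max = ord0) ?ffun_cons0; last exact: val_inj.
  rewrite (bigD1 i)//= [X in _ + X]big1 => [|j ji]; last first.
    by rewrite expr0 mxE eq_sym (negPf ji) mul0r.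
  by rewrite expr0 mxE eqxx mul1r addr0.
rewrite sum_ffun_cons.
under [RHS]eq_bigr do rewrite exprS mxE mulr_suml.
rewrite [RHS]exchange_big /=; apply: eq_bigr => k _.
under [RHS]eq_bigr do rewrite -mulrA.
rewrite -mulr_sumr -IH mulr_sumr; apply: eq_bigr => u _.
rewrite big_ord_recl (_ : widen_ord _ ord0 = ord0); last exact: val_inj.
rewrite !ffun_cons0 -mulrA; congr (_ * (_ * Y _)); last first.
  by rewrite (_ : ord_max = lift ord0 ord_max) ?ffun_consS//; exact: val_inj.
apply: eq_bigr => r _; rewrite ffun_consS.
rewrite (_ : widen_ord _ (lift ord0 r) = lift ord0 (widen_ord (leqnSn p) r)) ?ffun_consS//.
exact: val_inj.
Qed.

Lemma mxtrace_exp X p : \tr (X ^+ p.+1) =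
  \sum_(u : {ffun 'I_p.+1 -> 'I_N}) \prod_r X (u r) (u (ordS r)).
Proof.
rewrite sum_ffun_cons; apply: eq_bigr => i _.
rewrite exprSr mxE -sum_path_mx_exp; apply: eq_bigr => u _.
rewrite big_ord_recr /=; congr (_ * _); last first.
  by rewrite (_ : ordS ord_max = ord0) ?ffun_cons0//; apply: val_inj; rewrite /= modnn.
apply: eq_bigr => r _; rewrite (_ : ordS _ = lift ord0 r) ?ffun_consS.
  by congr (X (ffun_cons i u _) _); apply: val_inj.
by apply: val_inj; rewrite /= modn_small// ltnS.
Qed.
End TracePower.

Definition twist (K : pzRingType) (d n : nat) (s : 'I_n -> 'I_n -> K)
    (W : 'M[K]_(d * n)) : 'M[K]_(d * n) :=
  \matrix_(u, v) (s (mxtens_unindex u).2 (mxtens_unindex v).2 *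
    W (mxtens_index ((mxtens_unindex u).1, (mxtens_unindex v).2))
      (mxtens_index ((mxtens_unindex v).1, (mxtens_unindex u).2))).

Lemma twistE (K : pzRingType) d n (s : 'I_n -> 'I_n -> K) (W : 'M[K]_(d * n)) i a j b :
  twist s W (mxtens_index (i, a)) (mxtens_index (j, b)) =
  s a b * W (mxtens_index (i, b)) (mxtens_index (j, a)).
Proof. by rewrite mxE !mxtens_indexK. Qed.

Lemma id_tens_twist (K : pzRingType) d n (s : 'I_n -> 'I_n -> K)
    (f : 'M[K]_n -> 'M[K]_n) (W : 'M[K]_(d * n)) :
  (forall A a b, f A a b = s a b * A b a) -> id_tens f W = twist s W.
Proof.
move=> fs; apply/matrixP => u v.
case: (mxtens_indexP u) => i a; case: (mxtens_indexP v) => j b.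
rewrite twistE /id_tens summxE (bigD1 i)//= [X in _ + X]big1 ?addr0 => [|i' ii]; last first.
  by rewrite summxE big1// => j' _; rewrite tensmxE mxE (eq_sym i) (negPf ii) mul0r.
rewrite summxE (bigD1 j)//= [X in _ + X]big1 ?addr0 => [|j' jj]; last first.
  by rewrite tensmxE mxE (eq_sym j) (negPf jj) andbF mul0r.
by rewrite tensmxE mxE !eqxx mul1r fs mxE.
Qed.

Definition rot_perm p : 'S_p := perm (@ordS_inj p).

Lemma sum_ffun_mxtens (V : nmodType) (I : finType) d n (F : {ffun I -> 'I_(d * n)} -> V) :
  \sum_u F u = \sum_(i : {ffun I -> 'I_d}) \sum_(a : {ffun I -> 'I_n})
    F [ffun r => mxtens_index (i r, a r)].
Proof.
rewrite pair_bigA (reindex (fun ia : {ffun I -> 'I_d} * {ffun I -> 'I_n} =>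
  [ffun r => mxtens_index (ia.1 r, ia.2 r)])) //=.
exists (fun u : {ffun I -> 'I_(d * n)} => ([ffun r => (mxtens_unindex (u r)).1],
    [ffun r => (mxtens_unindex (u r)).2])) => [[i a] _|u _].
  by congr (_, _); apply/ffunP => r; rewrite !ffunE mxtens_indexK.
by apply/ffunP => r; rewrite !ffunE -surjective_pairing mxtens_unindexK.
Qed.

Lemma sum_invariant_ffun (K : pzSemiRingType) (T D : finType) (s : {perm T}) :
  \sum_(f : {ffun T -> D}) [forall x, f x == f (s x)]%:R =
  ((#|D| ^ #|porbits s|)%N)%:R :> K.
Proof.
rewrite -card_invariant_ffun -sum1_card natr_sum [RHS]big_mkcond /=.
by apply: eq_bigr => f _; rewrite inE; case: ifP.
Qed.

(** * Exact moments for fixed [d] *)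

Section StarMoment.
Local Open Scope classical_set_scope.
Local Open Scope ring_scope.
Local Open Scope complex_scope.
Variables (R : realType) (d n m : nat) (s : 'I_n -> 'I_n -> R[i]).
Hypotheses (sC : forall a b, s a b = s b a) (sR : forall a b, ((s a b)^*)%R = s a b).
Implicit Types (G : 'M[R[i]]_(d * n, d * m)).

Lemma wishart_entry G u v :
  wishart G u v = ((d * m)%:R)^-1 * \sum_k G u k * ((G v k)^*)%R.
Proof. by rewrite !mxE; congr (_ * _); apply: eq_bigr => k _; rewrite !mxE. Qed.

Lemma twist_wishart_adjoint G :
  ((twist s (wishart G)) ^t*)%sesqui = twist s (wishart G).
Proof.
apply/matrixP => u v; rewrite !mxE.
rewrite rmorphM /= sR sC rmorphM fmorphV rmorph_nat rmorph_sum /=; congr (_ * (_ * _)).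
by apply: eq_bigr => k _; rewrite !mxE rmorphM /= conjCK mulrC.
Qed.

Lemma star_word_twist_wishart G w :
  star_word (twist s (wishart G)) w = twist s (wishart G) ^+ size w.
Proof.
elim: w => [|e w IH]; first by rewrite /star_word big_nil expr0.
rewrite /star_word big_cons -/(star_word _ w) IH /= exprS.
by case: e; rewrite ?twist_wishart_adjoint.
Qed.

Definition cycle_weight p (a : {ffun 'I_p -> 'I_n}) : R[i] :=
  \prod_r s (a r) (a (rot_perm p r)).

(** Signed count of the colourings compatible with [g]: in the term of [g] the signs [s] enter only
    here. *)
Definition perm_weight p (g : 'S_p) : R[i] :=
  \sum_(a : {ffun 'I_p -> 'I_n} | [forall r, a (rot_perm p r) == a (g r)]) cycle_weight a.

(** Indices of the r-th unconjugated and conjugated entries of [G]; [c] collects block indices,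
    colours and summed columns. The twist shows in the rotation acting on the colours of [wordx] but
    on the block indices of [wordy]. *)
Let wordx p (c : {ffun 'I_p -> 'I_d} * {ffun 'I_p -> 'I_n} * {ffun 'I_p -> 'I_(d * m)}) r :=
  (mxtens_index (c.1.1 r, c.1.2 (rot_perm p r)), c.2 r).
Let wordy p (c : {ffun 'I_p -> 'I_d} * {ffun 'I_p -> 'I_n} * {ffun 'I_p -> 'I_(d * m)}) r :=
  (mxtens_index (c.1.1 (rot_perm p r), c.1.2 r), c.2 r).

Lemma mxtrace_twist_wishart G p : \tr (twist s (wishart G) ^+ p.+1) =
  \sum_c ((d * m)%:R ^- p.+1 * cycle_weight c.1.2) *
    \prod_r (G (@wordx p.+1 c r).1 (wordx c r).2 * ((G (wordy c r).1 (wordy c r).2)^*)%R).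
Proof.
rewrite mxtrace_exp sum_ffun_mxtens pair_bigA /=.
rewrite -(pair_bigA _ (fun (ia : {ffun 'I_p.+1 -> 'I_d} * {ffun 'I_p.+1 -> 'I_n}) k =>
  ((d * m)%:R ^- p.+1 * cycle_weight ia.2) *
    \prod_r (G (@wordx p.+1 (ia, k) r).1 (wordx (ia, k) r).2 *
       ((G (wordy (ia, k) r).1 (wordy (ia, k) r).2)^*)%R))) /=.
apply: eq_bigr => -[i a] _ /=; rewrite -mulr_sumr.
under eq_bigr do rewrite !ffunE twistE wishart_entry.
rewrite big_split big_split /= prodr_const card_ord exprVn mulrCA mulrA; congr (_ * _ * _).
  by apply: eq_bigr => r _; rewrite permE.
by rewrite bigA_distr_bigA; apply: eq_bigr => k _; apply: eq_bigr => r _; rewrite !permE.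
Qed.

(** The colours are transposed, so they compare the rotation with [g]; untransposed, they would obey
    the same constraint as the block indices. *)
Let word_match p c (g : 'S_p) :
  [forall r, wordx c r == wordy c (g r)] =
  [&& [forall r, c.1.1 r == c.1.1 ((g * rot_perm p)%g r)],
    [forall r, c.1.2 (rot_perm p r) == c.1.2 (g r)] & [forall r, c.2 r == c.2 (g r)]].
Proof.
have E r : (wordx c r == wordy c (g r)) = [&& c.1.1 r == c.1.1 ((g * rot_perm p)%g r),
    c.1.2 (rot_perm p r) == c.1.2 (g r) & c.2 r == c.2 (g r)].
  by rewrite xpair_eqE (can_eq (@mxtens_indexK _ _)) xpair_eqE -andbA permM.
apply/forallP/and3P => [H|[/forallP H1 /forallP H2 /forallP H3] r].
  by split; apply/forallP => r; have := H r; rewrite E => /and3P[].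
by rewrite E H1 H2 H3.
Qed.

(** After [wick] the sums over block indices, colours and columns separate; they give the power of
    [d], [perm_weight] and the power of [d * m]. *)
Lemma star_moment_twist_wishart (dT : measure_display) (T : measurableType dT)
    (P : probability T R) (G : T -> 'M[R[i]]_(d * n, d * m)) (w : seq bool) p :
  complex_ginibre P G -> size w = p.+1 ->
  star_moment P (fun t => twist s (wishart (G t))) w =
  \sum_(g : 'S_p.+1) (d * n)%:R^-1 * (d * m)%:R ^- p.+1 * perm_weight g *
    (d ^ #|porbits (g * rot_perm p.+1)%g| * (d * m) ^ #|porbits g|)%N%:R.
Proof.
move=> ginG sw; rewrite /star_moment.
pose Z (c : {ffun 'I_p.+1 -> 'I_d} * {ffun 'I_p.+1 -> 'I_n} * {ffun 'I_p.+1 -> 'I_(d * m)}) t :=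
  \prod_r (G t (wordx c r).1 (wordx c r).2 * ((G t (wordy c r).1 (wordy c r).2)^*)%R).
have E t : normalized_trace (star_word (twist s (wishart (G t))) w) =
   \sum_c ((d * n)%:R^-1 * (d * m)%:R ^- p.+1 * cycle_weight c.1.2) * Z c t.
  rewrite star_word_twist_wishart /normalized_trace sw mxtrace_twist_wishart mulrC mulr_sumr.
  by apply: eq_bigr => c _; rewrite !mulrA.
rewrite (funext E) cexpectation_sum; last by move=> c _; exact: complex_integrable_wick.
under eq_bigr do rewrite wick// mulr_sumr.
rewrite exchange_big; apply: eq_bigr => g _ /=.
have andR (b1 b2 b3 : bool) : [&& b1, b2 & b3]%:R = b1%:R * b2%:R * b3%:R :> R[i].
  by case: b1 b2 b3 => -[] []; rewrite /= ?mul1r ?mul0r ?mulr0.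
under eq_bigr do rewrite word_match andR.
transitivity (\sum_(i : {ffun 'I_p.+1 -> 'I_d}) \sum_(a : {ffun 'I_p.+1 -> 'I_n})
    \sum_(k : {ffun 'I_p.+1 -> 'I_(d * m)}) (d * n)%:R^-1 * (d * m)%:R ^- p.+1 *
  (cycle_weight a * [forall r, a (rot_perm p.+1 r) == a (g r)]%:R) *
  ([forall r, i r == i ((g * rot_perm p.+1)%g r)]%:R * [forall r, k r == k (g r)]%:R)).
  rewrite pair_bigA pair_bigA; apply: eq_bigr => -[[i a] k] _ /=.
  set x := [forall r, i r == _]; set y := [forall r, k r == _]; set z := [forall r, _ == a _].
  by rewrite -!mulrA; congr (_ * (_ * (_ * _))); rewrite mulrCA.
transitivity ((d * n)%:R^-1 * (d * m)%:R ^- p.+1 * perm_weight g *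
  ((\sum_(i : {ffun 'I_p.+1 -> 'I_d}) [forall r, i r == i ((g * rot_perm p.+1)%g r)]%:R) *
   \sum_(k : {ffun 'I_p.+1 -> 'I_(d * m)}) [forall r, k r == k (g r)]%:R)).
  under eq_bigr do under eq_bigr do rewrite -mulr_sumr -mulr_sumr.
  rewrite exchange_big /=; under eq_bigr do rewrite -mulr_sumr -mulr_suml.
  rewrite -mulr_suml -mulr_sumr; congr (_ * _ * _).
  rewrite /perm_weight [RHS]big_mkcond; apply: eq_bigr => a _ /=.
  by case: ifP => _; rewrite ?mulr1 ?mulr0.
by rewrite !sum_invariant_ffun !card_ord -natrM.
Qed.
End StarMoment.

(** * The limit *)

Section Limit.
Local Open Scope classical_set_scope.
Local Open Scope ring_scope.
Local Open Scope complex_scope.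
Variable R : realType.

Lemma cvg_natr_inv : ((fun d => d%:R^-1) : nat -> (R[i])^o) @ \oo --> (0 : (R[i])^o).
Proof.
apply/cvgr0Pnorm_lt => -[e e'] ee.
(* A positive element of [R[i]] is real, so the imaginary part of the radius vanishes. *)
have [e0 e'0] : 0 < e /\ e' = 0 by move: ee; rewrite ltcE /= => /andP[/eqP -> ].
have H : \forall d \near \oo, (harmonic d : R) < e.
  have /cvgr0Pnorm_lt/(_ e e0) := @cvg_harmonic R; apply: filterS => d.
  by apply: le_lt_trans; exact: ler_norm.
have [N _ HN] := H; exists N.+1 => //= -[//|d] /HN /= lt.
rewrite e'0 normrV ?unitfE ?pnatr_eq0// normr_nat.
rewrite (_ : d.+1%:R^-1 = ((harmonic d : R))%:C) ?ltcR//.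
by rewrite /harmonic /= fmorphV rmorph_nat.
Qed.

Lemma cvg_natrX_ratio (e N : nat) : (e <= N)%N ->
  ((fun d => (d ^ e)%N%:R / d%:R ^+ N) : nat -> (R[i])^o) @ \oo --> ((e == N)%:R : (R[i])^o).
Proof.
move=> eN.
(* The two sides may differ at [d = 0], where the inverse takes its default value. *)
have E : \forall d \near \oo, (d%:R^-1 : R[i]) ^+ (N - e) = (d ^ e)%N%:R / d%:R ^+ N.
  exists 1%N => //= -[//|d] _.
  have d0 : d.+1%:R ^+ e != 0 :> R[i] by rewrite expf_neq0 ?pnatr_eq0.
  by rewrite natrX -{2}(subnKC eN) exprD invfM mulrA (divff d0) mul1r exprVn.
suff H : ((fun d => (d%:R^-1 : R[i]) ^+ (N - e)) : nat -> (R[i])^o) @ \oo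
    --> ((e == N)%:R : (R[i])^o) by exact: cvg_trans (near_eq_cvg E) H.
case: (eqVneq e N) => [->|eN'].
  by rewrite subnn; under eq_fun do rewrite expr0; exact: (@cvg_cst (R[i])^o).
have [k ->] : exists k, (N - e = k.+1)%N.
  by exists (N - e).-1; rewrite prednK// subn_gt0 ltn_neqAle eN'.
elim: k => [|k IH]; first by under eq_fun do rewrite expr1; exact: cvg_natr_inv.
under eq_fun do rewrite exprS.
have H : ((fun d => d%:R^-1 * d%:R^-1 ^+ k.+1) : nat -> (R[i])^o) @ \oo
    --> ((0 : R[i]) * false%:R : (R[i])^o) by exact: cvgM cvg_natr_inv IH.
by rewrite mul0r in H.
Qed.

Lemma cvg_sum_complex (I : Type) (r : seq I) (f : I -> nat -> R[i]) (l : I -> R[i]) :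
  (forall i, (f i : nat -> (R[i])^o) @ \oo --> (l i : (R[i])^o)) ->
  ((fun d => \sum_(i <- r) f i d) : nat -> (R[i])^o) @ \oo --> (\sum_(i <- r) l i : (R[i])^o).
Proof.
move=> fl; elim: r => [|i r IH].
  rewrite big_nil (_ : (fun d => _) = fun=> 0); first exact: (@cvg_cst (R[i])^o).
  by apply/funext => d; rewrite big_nil.
rewrite big_cons (_ : (fun d => _) = fun d => f i d + \sum_(j <- r) f j d).
  by apply: (@cvgD _ (R[i])^o); [exact: fl|exact: IH].
by apply/funext => d; rewrite big_cons.
Qed.
End Limit.

Lemma card_porbits_rot p : #|porbits (rot_perm p.+1)| = 1%N.
Proof.
suff -> : porbits (rot_perm p.+1) = [set porbit (rot_perm p.+1) ord0]%SET by rewrite cards1.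
apply/setP => O; rewrite !inE; apply/imsetP/eqP => [[x _ ->]|->]; last by exists ord0.
apply/eqP; rewrite eq_porbit_mem; case: x => k; elim: k => [|k IH] ltk.
  by rewrite (_ : Ordinal ltk = ord0) ?porbit_id//; exact: val_inj.
have ltk' : (k < p.+1)%N by exact: ltnW.
rewrite (_ : Ordinal ltk = rot_perm p.+1 (Ordinal ltk')); last first.
  by apply: val_inj; rewrite permE /= modn_small.
by rewrite -eq_porbit_mem (porbit_perm _ 1) eq_porbit_mem IH.
Qed.

(** Common limit for words of length [p.+1]: colourings are counted without sign, so it is the same
    for both maps. *)
Definition limit_moment (R : realType) (n m p : nat) : R[i] :=
  \sum_(g : 'S_p.+1 | geodesic g (rot_perm p.+1))
    n%:R^-1 * m%:R ^- p.+1 * m%:R ^+ #|porbits g| *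
    #|[pred a : {ffun 'I_p.+1 -> 'I_n} | [forall r, a (rot_perm p.+1 r) == a (g r)]]|%:R.

(** * Convergence of the moments for both maps at once *)

Section Asymptotics.
Local Open Scope classical_set_scope.
Local Open Scope ring_scope.
Local Open Scope complex_scope.
Variables (R : realType) (n m : nat) (s : 'I_n -> 'I_n -> R[i]).
Hypothesis n_gt0 : (0 < n)%N.
Variable f : 'M[R[i]]_n -> 'M[R[i]]_n.
Hypothesis fE : forall A a b, f A a b = s a b * A b a.
Hypothesis s_sign : (forall a b, s a b = 1) \/
  (forall a b, s a b = if a == b then 1 else -1).
Variables (disp : nat -> measure_display) (T : forall d : nat, measurableType (disp d))
  (P : forall d : nat, probability (T d) R)
  (G : forall d : nat, T d -> 'M[R[i]]_(d * n, d * m)).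
Hypothesis ginG : forall d : nat, complex_ginibre (P d) (@G d).

Let sC a b : s a b = s b a.
Proof. by case: s_sign => E; rewrite !E// eq_sym. Qed.

Let sR a b : ((s a b)^*)%R = s a b.
Proof. by case: s_sign => ->; [|case: ifP => _]; rewrite ?rmorphN rmorph1. Qed.

Let perm_weight_geodesic p (g : 'S_p.+1) : geodesic g (rot_perm p.+1) ->
  perm_weight s g =
  #|[pred a : {ffun 'I_p.+1 -> 'I_n} | [forall r, a (rot_perm p.+1 r) == a (g r)]]|%:R.
Proof.
move=> geo; rewrite /perm_weight -sum1_card natr_sum; apply: eq_big => [a|a /forallP H].
  by rewrite inE.
rewrite /cycle_weight; case: s_sign => E; first by rewrite big1.
under eq_bigr do rewrite E.
by apply: (geodesic_prod_sign _ geo) => r; apply/eqP.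
Qed.

Lemma cvg_star_moment_id_tens :
  asymptotic_distribution P (fun d t => id_tens f (wishart (@G d t)))
    (fun w => if size w is p.+1 then limit_moment R n m p else 1).
Proof.
move=> w; have momE d : star_moment (P d) (fun t => id_tens f (wishart (G t))) w =
    star_moment (P d) (fun t => twist s (wishart (G t))) w.
  by congr (star_moment _ _ w); apply/funext => t; exact: id_tens_twist.
case E : (size w) => [|p].
  have {E} wE : w = [::] by case: w E {momE}.
  rewrite {}wE in momE *.
  (* The empty word gives the identity, whose normalized trace is 1 once the matrix is nonempty,
     that is for [d >= 1]. *)
  apply: cvg_near_cst; exists 1%N => //= d d0; rewrite momE.
  rewrite /star_moment (_ : (fun t => _) = fun=> 1); last first.
    apply/funext => t; rewrite /normalized_trace /star_word big_nil mxtrace1 divff//.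
    by rewrite pnatr_eq0 -lt0n muln_gt0 d0.
  by rewrite /cexpectation /= (expectation_cst (P d) 1) (expectation_cst (P d) 0).
(* [c g] gathers what does not depend on [d], its power of [m] coming from the orbits that carry
   columns. [e g] is the exponent of [d] in the numerator; the denominator has [p.+2], one from the
   trace and [p.+1] from the Wishart normalization. *)
pose c (g : 'S_p.+1) := n%:R^-1 * m%:R ^- p.+1 * m%:R ^+ #|porbits g| * perm_weight s g.
pose e (g : 'S_p.+1) := (#|porbits g| + #|porbits (g * rot_perm p.+1)%g|)%N.
have le_e g : (e g <= p.+2)%N.
  by have := genus_le g (rot_perm p.+1); rewrite card_porbits_rot card_ord.
have geoE g : geodesic g (rot_perm p.+1) = (e g == p.+2).
  by rewrite /geodesic card_porbits_rot card_ord.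
have S : \forall d \near \oo, \sum_g c g * ((d ^ e g)%N%:R / d%:R ^+ p.+2) =
    star_moment (P d) (fun t => id_tens f (wishart (@G d t))) w.
  exists 1%N => //= d d0; rewrite momE (star_moment_twist_wishart sC sR (ginG d) E).
  apply: eq_bigr => g _; rewrite /c /e expnD expnMn !natrM !natrX.
  have dn0 : (d%:R : R[i]) != 0 by rewrite pnatr_eq0 -lt0n.
  rewrite [_ ^+ p.+2]exprS exprMn !invfM.
  have mulACA (K : comPzRingType) (a b y c0 x u v z : K) :
      a * b * y * c0 * (x * u * (v * z)) = v * a * (z * b) * c0 * (u * (x * y)) by ring.
  exact: mulACA.
have -> : limit_moment R n m p = \sum_g c g * (e g == p.+2)%:R.
  rewrite /limit_moment big_mkcond; apply: eq_bigr => g _.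
  by rewrite -geoE; case: ifP => [geo|_]; rewrite ?mulr0// mulr1 /c perm_weight_geodesic.
suff H : ((fun d => \sum_g c g * ((d ^ e g)%N%:R / d%:R ^+ p.+2)) : nat -> (R[i])^o) @ \oo
    --> (\sum_g c g * (e g == p.+2)%:R : (R[i])^o).
  exact: cvg_trans (near_eq_cvg S) H.
have H g : ((fun d => c g * ((d ^ e g)%N%:R / d%:R ^+ p.+2)) : nat -> (R[i])^o) @ \oo
    --> (c g * (e g == p.+2)%:R : (R[i])^o).
  by apply: cvgM; [exact: cvg_cst|exact: cvg_natrX_ratio].
exact: cvg_sum_complex H.
Qed.
End Asymptotics.

Theorem theorem7p7 (R : realType) (n m : nat) (n_gt0 : (0 < n)%N)
    (m_gt0 : (0 < m)%N) :
  [/\ forall p : {set {set legs 2 2}},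
        is_part_even p && crossing p <-> p = crossing_pairing,
      forall A : 'M[R[i]]_n,
        phibar crossing_pairing A = diag_part A *+ 2 - A^T,
      forall A : 'M[R[i]]_n, phi crossing_pairing A = A^T
    & forall (disp : nat -> measure_display)
             (T : forall d : nat, measurableType (disp d))
             (P : forall d : nat, probability (T d) R)
             (G : forall d : nat, T d -> 'M[R[i]]_(d * n, d * m)),
        (forall d : nat, complex_ginibre (P d) (G d)) ->
        exists mu : seq bool -> R[i],
          asymptotic_distribution P
            (fun d t => id_tens (phibar crossing_pairing) (wishart (G d t))) mu
          /\
          asymptotic_distribution P
            (fun d t => id_tens (phi crossing_pairing) (wishart (G d t))) mu].
Proof.
split; [|exact: phibar_crossing|exact: phi_crossing|].
  move=> p; split=> [/andP[/andP[pp _]]|->]; first exact: crossing_part22.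
  by rewrite part_even_crossing_pairing crossing_crossing_pairing.
move=> disp T P G ginG.
exists (fun w => if size w is p.+1 then limit_moment R n m p else 1); split.
  apply: (cvg_star_moment_id_tens n_gt0 _ (s := fun a b => if a == b then 1 else -1)) => //.
    exact: phibar_crossingE.
  by right.
apply: (cvg_star_moment_id_tens n_gt0 _ (s := fun _ _ => 1)) => // [A a b|]; last by left.
by rewrite phi_crossing mxE mul1r.
Qed.
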